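(* There exists a dense $G_\delta$ subset $E\subset[0,1]$ such that for every $\alpha\in E$, the closure $\overline{\mathcal{A}_\alpha}$ of $\mathcal{A}_\alpha$ in $(\mathrm{Diff}(\mathbb{T}^2),\tau)$ contains a subset which is dense in $\overline{\mathcal{A}_\alpha}$ and consists of uniquely ergodic diffeomorphisms.
   Context: $\mathbb{T}^2=\mathbb{R}^2/\mathbb{Z}^2$. $\mathrm{Diff}(\mathbb{T}^2)$ is the set of real-analytic diffeomorphisms of $\mathbb{T}^2$ homotopic to the identity; each has a lift $F(x,y)=(x+f_1(x,y),y+f_2(x,y))$ with $f_1,f_2$ real-analytic and $\mathbb{Z}^2$-periodic. For $r>0$ let $A^r=\{(x,y)\in\mathbb{C}^2:|\mathrm{Im}\,x|<r,\ |\mathrm{Im}\,y|<r\}$, and let $\mathrm{Diff}_r(\mathbb{T}^2)$ be the set of those $F$ for which $f_1,f_2$ extend holomorphically to $A^r$ with finite sup norm; it carries the topology $\tau_r$ of the distance $|F-G|_r=\max_{i=1,2}\sup_{A^r}|f_i-g_i|$. The topology $\tau$ on $\mathrm{Diff}(\mathbb{T}^2)=\bigcup_{r>0}\mathrm{Diff}_r(\mathbb{T}^2)$ is the inductive limit topology: a set $O$ is open iff $O\cap\mathrm{Diff}_r(\mathbb{T}^2)$ is $\tau_r$-open for every $r>0$. $R_\alpha(x,y)=(x+\alpha,y)$. $\mathcal{A}_\alpha$ is the set of $F\in\mathrm{Diff}(\mathbb{T}^2)$ such that $F=T^{-1}\circ R_\alpha\circ T$ for some real-analytic area-preserving diffeomorphism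 $T$ of $\mathbb{T}^2$. A homeomorphism of a compact space is uniquely ergodic if it has exactly one invariant Borel probability measure. *)

(* Defs.v *)
From mathcomp Require Import all_boot all_order all_algebra.
From mathcomp Require Import all_classical all_reals all_analysis.
From mathcomp Require Import Rstruct Rstruct_topology.
From mathcomp Require Import complex.

Set Implicit Arguments.
Unset Strict Implicit.
Unset Printing Implicit Defensive.

Import Order.TTheory GRing.Theory Num.Theory.
Local Open Scope classical_set_scope.
Local Open Scope ring_scope.

Notation RR := Rdefinitions.R.
Notation CC := (complex Rdefinitions.R).

(* maps R^2 -> R^2 (lifts of maps of T^2 = R^2/Z^2) *)
Definition Map := (RR * RR -> RR * RR)%type.

Definition strip (r : RR) : set (CC * CC) :=
  [set z | `|complex.Im z.1| < r /\ `|complex.Im z.2| < r].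

Definition holomorphic_on (U : set (CC * CC)) (g : CC * CC -> CC) : Prop :=
  forall z, U z -> exists l1 l2 : CC, forall eps : RR, 0 < eps ->
    exists delta : RR, 0 < delta /\
      forall h1 h2 : CC, `|h1| < (delta%:C)%C -> `|h2| < (delta%:C)%C ->
        `|g (z.1 + h1, z.2 + h2) - g z - l1 * h1 - l2 * h2|
          <= (eps%:C)%C * (`|h1| + `|h2|).

Definition hol_ext (r : RR) (f : RR -> RR -> RR) (g : CC * CC -> CC) : Prop :=
  holomorphic_on (strip r) g /\
  (exists M : RR, forall z, strip r z -> `|g z| <= (M%:C)%C) /\
  (forall x y : RR, g ((x%:C)%C, (y%:C)%C) = ((f x y)%:C)%C).

Definition periodic2 (f : RR -> RR -> RR) : Prop :=
  forall x y : RR, f (x + 1) y = f x y /\ f x (y + 1) = f x y.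

Definition real_analytic_periodic (f : RR -> RR -> RR) : Prop :=
  periodic2 f /\ exists r : RR, 0 < r /\ exists g, hol_ext r f g.

Definition disp1 (F : Map) : RR -> RR -> RR := fun x y => (F (x, y)).1 - x.
Definition disp2 (F : Map) : RR -> RR -> RR := fun x y => (F (x, y)).2 - y.

Definition id_type_lift (F : Map) : Prop :=
  real_analytic_periodic (disp1 F) /\ real_analytic_periodic (disp2 F).

(* Diff(T^2): (lifts of) real-analytic diffeomorphisms of T^2 homotopic to
   the identity *)
Definition in_Diff (F : Map) : Prop :=
  id_type_lift F /\
  exists G : Map, id_type_lift G /\ (forall p, G (F p) = p) /\
                  (forall p, F (G p) = p).

Definition in_Diff_r (r : RR) (F : Map) : Prop :=
  in_Diff F /\ (exists g1, hol_ext r (disp1 F) g1) /\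
               (exists g2, hol_ext r (disp2 F) g2).

Definition dist_lt (r : RR) (F G : Map) (eps : RR) : Prop :=
  exists f1 f2 g1 g2,
    hol_ext r (disp1 F) f1 /\ hol_ext r (disp2 F) f2 /\
    hol_ext r (disp1 G) g1 /\ hol_ext r (disp2 G) g2 /\
    exists c : RR, c < eps /\
      forall z, strip r z ->
        `|f1 z - g1 z| <= (c%:C)%C /\ `|f2 z - g2 z| <= (c%:C)%C.

(* open sets of the inductive limit topology tau on Diff(T^2) *)
Definition tau_open (O : set Map) : Prop :=
  O `<=` in_Diff /\
  forall r : RR, 0 < r -> forall F, O F -> in_Diff_r r F ->
    exists eps : RR, 0 < eps /\
      forall G, in_Diff_r r G -> dist_lt r F G eps -> O G.

Definition tau_closure (S : set Map) : set Map :=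
  [set F | in_Diff F /\
     forall O, tau_open O -> O F -> exists G, O G /\ S G].

(* general lift of a real-analytic map of T^2: F(p) = A p + periodic
   real-analytic, A an integer 2x2 matrix (a b; c d) *)
Definition analytic_lift (F : Map) : Prop :=
  exists a b c d : int,
    real_analytic_periodic
      (fun x y => (F (x, y)).1 - (a%:~R * x + b%:~R * y)) /\
    real_analytic_periodic
      (fun x y => (F (x, y)).2 - (c%:~R * x + d%:~R * y)).

Definition analytic_diffeo_lift (T : Map) : Prop :=
  analytic_lift T /\
  exists S : Map, analytic_lift S /\ (forall p, S (T p) = p) /\
                  (forall p, T (S p) = p).

(* Measures on T^2 are encoded as Borel measures on R^2 concentrated on the
   fundamental domain [0,1)^2, which is Borel-isomorphic to T^2. *)
Definition T2 := (measurableTypeR RR * measurableTypeR RR)%type.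

Definition frac (x : RR) : RR := x - (Num.floor x)%:~R.

Definition fund_dom : set T2 :=
  [set p | (0 <= p.1 < 1) /\ (0 <= p.2 < 1)].

Definition torus_map (F : Map) : T2 -> T2 :=
  fun p => (frac (F p).1, frac (F p).2).

Definition leb_T2 (A : set T2) : \bar RR :=
  ((@lebesgue_measure RR \x @lebesgue_measure RR) (A `&` fund_dom))%E.

Definition area_preserving (T : Map) : Prop :=
  forall A : set T2, measurable A ->
    leb_T2 (torus_map T @^-1` A) = leb_T2 A.

Definition A_alpha (alpha : RR) : set Map :=
  [set F | in_Diff F /\
     exists T : Map, analytic_diffeo_lift T /\ area_preserving T /\
       forall p, exists k1 k2 : int,
         T (F p) = ((T p).1 + alpha + k1%:~R, (T p).2 + k2%:~R)].

Definition invariant_prob (F : Map)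
    (mu : {measure set T2 -> \bar RR}) : Prop :=
  mu setT = 1%E /\ mu (~` fund_dom) = 0%E /\
  forall A : set T2, measurable A -> mu (torus_map F @^-1` A) = mu A.

Definition uniquely_ergodic (F : Map) : Prop :=
  (exists mu, invariant_prob F mu) /\
  forall mu nu, invariant_prob F mu -> invariant_prob F nu ->
    forall A : set T2, measurable A -> mu A = nu A.

(* Main.v *)
Require Import Defs.
From HB Require Import structures.
From mathcomp Require Import all_boot all_order all_algebra.
From mathcomp Require Import all_classical all_reals all_analysis.
From mathcomp Require Import Rstruct Rstruct_topology.
From mathcomp Require Import measurable_realfun borel_hierarchy.
From mathcomp Require Import complex ring lra.
Import Order.TTheory GRing.Theory Num.Theory.
Import numFieldNormedType.Exports.
Local Open Scope classical_set_scope.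
Local Open Scope ring_scope.

Set Implicit Arguments.
Unset Strict Implicit.
Unset Printing Implicit Defensive.

(** E is the set of irrationals of [0, 1]. The conjugacies in the definition of
    A_alpha may have any linear part in GL_2(Z), so A_alpha contains, for every
    unimodular matrix A, the translation by A^-1 (alpha, 0). When alpha is
    irrational these translations are dense among all translations of the torus:
    A^-1 (alpha, 0) can be (d alpha, (1 + m d) alpha), where d alpha and then
    m (d alpha) are prescribed modulo 1 up to a small error.

    An element of A_alpha has the form S R_w T with S the inverse of T and R_w a
    translation. All the maps S R_w T, w in R^2, extend to one and the same
    complex strip, on which they depend on w in a Lipschitz way: this is the
    Cauchy estimate for bounded holomorphic functions, obtained from Goursat's
    lemma on rectangles. Hence every S R_w T lies in the closure of A_alpha, and
    S R_w T is approximated by S R_v T, where v generates a dense subgroup of the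
    torus (such v are dense by Baire).

    Finally S R_v T is uniquely ergodic. A measure invariant under R_v is
    invariant under all translations, and two translation invariant
    probabilities P and Q agree on A: both are the value of the double integral
    of the indicator of p + q in A. *)

(** * Goursat's lemma and the Cauchy estimate *)

(** The definition of [hol_ext] bounds an extension but not its derivatives, while two estimates
    need such a bound. One is the dependence of S R_w T on w. The other is the choice of the common
    strip: the extension of T must send a thin strip into the strip where S extends. This holds
    because its periodic part g is real on R^2 and Lipschitz, so that |Im g(z)| is at most a
    constant times |Im z1| + |Im z2|; a real translation changes no imaginary part, whence the same
    strip for every w. A common strip is what the inductive limit topology calls for: an open set
    around S R_w T contains a ball only inside each [in_Diff_r], so the approximants must all lie in
    the same one. The linear parts of S and T are inverse to each other, so S R_w T is homotopic to
    the identity whatever the linear part of T. The Cauchy estimate only uses a positive lower bound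
    for the circulation of 1/(z - z0), so squares replace circles and the exact value 2 pi is never
    computed. *)

Lemma eqR_le (R : numDomainType) (x y : R) : x = y -> x <= y.
Proof. by move=> ->. Qed.

(** * Integrals of continuous functions over segments *)

Section SegmentIntegral.
Variable R : realType.
Implicit Types (f g : R -> R) (a b c M : R).

(** Continuity is two-sided even at the endpoints: it will come from differentiability at every
    point of the segment, and it passes to subsegments without any argument about subspaces. *)
Definition cont_on f a b := forall x, a <= x <= b -> {for x, continuous f}.

Definition seg_int f a b := \int[@lebesgue_measure R]_(x in `[a, b]) f x.

Lemma cont_on_integrable f a b : cont_on f a b ->
  (@lebesgue_measure R).-integrable `[a, b] (EFin \o f).
Proof.
move=> cf; apply: continuous_compact_integrable; first exact: segment_compact.
apply: continuous_in_subspaceT => x; rewrite inE/= in_itv/= => xab.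
exact: cf.
Qed.

Lemma cont_on_sub f a b c d : a <= c -> d <= b -> cont_on f a b -> cont_on f c d.
Proof. by move=> ac db cf x /andP[cx xd]; apply: cf; apply/andP; split; lra. Qed.

Lemma cont_onB f g a b : cont_on f a b -> cont_on g a b ->
  cont_on (fun x => f x - g x) a b.
Proof.
move=> cf cg x xab.
by apply: cvgB; [exact: cf|exact: cg].
Qed.

Lemma seg_intB f g a b : cont_on f a b -> cont_on g a b ->
  seg_int (fun x => f x - g x) a b = seg_int f a b - seg_int g a b.
Proof.
by move=> /cont_on_integrable cf /cont_on_integrable cg; exact: RintegralB.
Qed.

Lemma seg_int_cst c a b : a <= b -> seg_int (fun=> c) a b = c * (b - a).
Proof.
move=> ab; rewrite /seg_int Rintegral_cst//=.
by rewrite lebesgue_measure_itv/= lte_fin; case: ltP => //= ba; congr *%R; lra.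
Qed.

Lemma eq_seg_int f g a b : (forall x, a <= x <= b -> f x = g x) ->
  seg_int f a b = seg_int g a b.
Proof.
by move=> fg; apply: eq_Rintegral => x; rewrite inE/= in_itv/=; exact: fg.
Qed.

Lemma seg_int_chasles f a b c : a <= c -> c <= b -> cont_on f a b ->
  seg_int f a b = seg_int f a c + seg_int f c b.
Proof.
move=> ac cb cf; have If := cont_on_integrable cf.
apply/eqP; rewrite addrC -subr_eq; apply/eqP.
rewrite /seg_int Rintegral_itvB//; apply: Rintegral_itv_obnd_cbnd.
apply: integrableS If => //; apply: subset_itv => //.
Qed.

Lemma le_seg_int f g a b : cont_on f a b -> cont_on g a b ->
  (forall x, a <= x <= b -> f x <= g x) -> seg_int f a b <= seg_int g a b.
Proof.
move=> /cont_on_integrable cf /cont_on_integrable cg fg.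
by apply: le_Rintegral => // x /=; rewrite in_itv; exact: fg.
Qed.

Lemma cont_on_cst c a b : cont_on (fun=> c) a b.
Proof. by move=> x _; exact: cvg_cst. Qed.

Lemma seg_int_dist f g a b M : a <= b -> cont_on f a b -> cont_on g a b ->
  (forall x, a <= x <= b -> `|f x - g x| <= M) ->
  `|seg_int f a b - seg_int g a b| <= M * (b - a).
Proof.
move=> ab cf cg fg; rewrite -seg_intB// ler_norml -mulNr -!seg_int_cst//.
apply/andP; split; apply: le_seg_int => //; try exact: cont_on_cst;
  try exact: cont_onB.
- by move=> x /fg; rewrite ler_norml => /andP[].
- by move=> x /fg; rewrite ler_norml => /andP[].
Qed.

End SegmentIntegral.

(** * Goursat's lemma for closed differential forms on rectangles *)

Section Goursat.
Variable R : realType.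
Implicit Types (P Q : R -> R -> R) (a b c d x y M : R).

(* Fréchet differentiability of P and Q at (x, y) together with the equality
   of mixed partials dP/dy = dQ/dx (= s), i.e. closedness of P dx + Q dy. *)
Definition closed_at P Q x y := exists p s q : R, forall e : R, 0 < e ->
  exists2 dl : R, 0 < dl & forall h k, `|h| < dl -> `|k| < dl ->
    `|P (x + h) (y + k) - P x y - (p * h + s * k)| <= e * (`|h| + `|k|) /\
    `|Q (x + h) (y + k) - Q x y - (s * h + q * k)| <= e * (`|h| + `|k|).

(** The integral of P dx + Q dy along the boundary of [a, b] x [c, d], counterclockwise: bottom,
    right, top, left. *)
Definition circ P Q a b c d :=
  seg_int (P ^~ c) a b + seg_int (Q b) c d
  - seg_int (P ^~ d) a b - seg_int (Q a) c d.

Lemma lin_approx_continuous (f : R -> R) (x l : R) :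
  (forall e : R, 0 < e -> exists2 dl : R, 0 < dl & forall h, `|h| < dl ->
    `|f (x + h) - f x - l * h| <= e * `|h|) -> {for x, continuous f}.
Proof.
move=> H; have [dl dl0 Hd] := H 1 ltr01.
apply/cvgrPdist_le => e e0.
have l0 : 0 < `|l| + 1 by have := normr_ge0 l; lra.
exists (Num.min dl (e / (`|l| + 1))) => /=.
  by rewrite lt_min dl0 divr_gt0.
move=> t /=; rewrite lt_min => /andP[xt1 xt2].
have := Hd (t - x); rewrite distrC => /(_ xt1); rewrite [x + _]addrC subrK => Ht.
have -> : f x - f t = - ((f t - f x - l * (t - x)) + l * (t - x)) by ring.
rewrite normrN (le_trans (ler_normD _ _))// normrM.
apply: (@le_trans _ _ ((`|l| + 1) * `|t - x|)).
  by rewrite [X in _ <= X]mulrDl [X in _ <= X]addrC lerD2r [X in _ <= _ * X]distrC.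
by rewrite mulrC -ler_pdivlMr// distrC ltW.
Qed.

Lemma closed_at_contP1 P Q x y : closed_at P Q x y ->
  {for x, continuous (P ^~ y)}.
Proof.
move=> [p [s [q H]]]; apply: (@lin_approx_continuous _ _ p) => e /H[dl dl0 Hd].
exists dl => // h hd; have [] := Hd h 0 hd; first by rewrite normr0.
by rewrite !addr0 mulr0 normr0 !addr0.
Qed.

Lemma closed_at_contQ2 P Q x y : closed_at P Q x y -> {for y, continuous (Q x)}.
Proof.
move=> [p [s [q H]]]; apply: (@lin_approx_continuous _ _ q) => e /H[dl dl0 Hd].
exists dl => // h hd; have [|_] := Hd 0 h _ hd; first by rewrite normr0.
by rewrite !addr0 mulr0 normr0 !add0r.
Qed.

Definition closed_on P Q a b c d :=
  forall x y, a <= x <= b -> c <= y <= d -> closed_at P Q x y.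

Definition circ_cont P Q a b c d :=
  [/\ cont_on (P ^~ c) a b, cont_on (Q b) c d, cont_on (P ^~ d) a b &
      cont_on (Q a) c d].

Definition on_boundary a b c d x y := [|| x == a, x == b, y == c | y == d].

Lemma boundary_neq a b c d (p q x y : R) : a < p < b -> c < q < d ->
  on_boundary a b c d x y -> (x != p) || (y != q).
Proof.
move=> /andP[ap pb] /andP[cq qd].
by case/or4P => /eqP ->; rewrite ?(lt_eqF ap) ?(gt_eqF pb) ?(lt_eqF cq) ?(gt_eqF qd) ?orbT.
Qed.

(** Closedness is asked on the boundary only, so that quotients with a pole inside the rectangle are
    covered. *)
Lemma closed_boundary_circ_cont P Q a b c d : a <= b -> c <= d ->
  (forall x y, a <= x <= b -> c <= y <= d -> on_boundary a b c d x y ->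
    closed_at P Q x y) -> circ_cont P Q a b c d.
Proof.
move=> ab cd H; split => z zab;
 do [apply: (@closed_at_contP1 _ Q)|apply: (@closed_at_contQ2 P)];
 by apply: H => //; rewrite ?lexx ?ab ?cd// /on_boundary eqxx ?orbT.
Qed.

Lemma closed_on_circ_cont P Q a b c d : a <= b -> c <= d ->
  closed_on P Q a b c d -> circ_cont P Q a b c d.
Proof. by move=> ab cd H; apply: closed_boundary_circ_cont => // *; exact: H. Qed.

Lemma circ_dist P Q P' Q' a b c d M : a <= b -> c <= d ->
  circ_cont P Q a b c d -> circ_cont P' Q' a b c d ->
  (forall x y, a <= x <= b -> c <= y <= d -> on_boundary a b c d x y ->
     `|P x y - P' x y| <= M /\ `|Q x y - Q' x y| <= M) ->
  `|circ P Q a b c d - circ P' Q' a b c d| <= 2 * M * ((b - a) + (d - c)).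
Proof.
move=> ab cd [c1 c2 c3 c4] [d1 d2 d3 d4] H.
have aab : a <= a <= b by rewrite lexx.
have bab : a <= b <= b by rewrite lexx ab.
have ccd : c <= c <= d by rewrite lexx.
have dcd : c <= d <= d by rewrite lexx cd.
have E1 := seg_int_dist ab c1 d1 (fun x hx => (H x c hx ccd _).1).
have E2 := seg_int_dist cd c2 d2 (fun x hx => (H b x bab hx _).2).
have E3 := seg_int_dist ab c3 d3 (fun x hx => (H x d hx dcd _).1).
have E4 := seg_int_dist cd c4 d4 (fun x hx => (H a x aab hx _).2).
rewrite /circ.
have {}E1 := E1 ltac:(by move=> *; rewrite /on_boundary eqxx ?orbT).
have {}E2 := E2 ltac:(by move=> *; rewrite /on_boundary eqxx ?orbT).
have {}E3 := E3 ltac:(by move=> *; rewrite /on_boundary eqxx ?orbT).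
have {}E4 := E4 ltac:(by move=> *; rewrite /on_boundary eqxx ?orbT).
move: E1 E2 E3 E4; rewrite !ler_norml.
move=> /andP[? ?] /andP[? ?] /andP[? ?] /andP[? ?]; apply/andP; split; lra.
Qed.

Lemma affine_continuous (f : R -> R) (A B x : R) : (forall x, f x = A + B * x) ->
  {for x, continuous f}.
Proof.
move=> fE; apply: (@lin_approx_continuous _ _ B) => e e0; exists 1 => // h _.
rewrite !fE; have -> : A + B * (x + h) - (A + B * x) - B * h = 0 by ring.
by rewrite normr0 mulr_ge0// ltW.
Qed.

Lemma circ_affine (A p s B q a b c d : R) : a <= b -> c <= d ->
  let P := fun x y => A + p * x + s * y in
  let Q := fun x y => B + s * x + q * y in
  circ_cont P Q a b c d /\ circ P Q a b c d = 0.
Proof.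
move=> ab cd P Q.
have cP y u v : cont_on (P ^~ y) u v.
  by move=> x _; apply: (@affine_continuous _ (A + s * y) p) => {}x; rewrite /P; ring.
have cQ x u v : cont_on (Q x) u v.
  by move=> y _; apply: (@affine_continuous _ (B + s * x) q) => {}y; rewrite /Q; ring.
split; first by split.
have -> : circ P Q a b c d = (seg_int (P ^~ c) a b - seg_int (P ^~ d) a b) +
   (seg_int (Q b) c d - seg_int (Q a) c d) by rewrite /circ; ring.
rewrite -!seg_intB//.
rewrite (@eq_seg_int _ _ (fun=> s * (c - d)))//; last first.
  by move=> x _; rewrite /P; ring.
rewrite (@eq_seg_int _ _ (fun=> s * (b - a)) c d)//; last first.
  by move=> x _; rewrite /Q; ring.
by rewrite !seg_int_cst//; ring.
Qed.

Lemma circ_splitx P Q a m b c d : a <= m -> m <= b -> c <= d ->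
  cont_on (P ^~ c) a b -> cont_on (P ^~ d) a b ->
  circ P Q a b c d = circ P Q a m c d + circ P Q m b c d.
Proof.
move=> am mb cd H1 H2; rewrite /circ (seg_int_chasles am mb H1) (seg_int_chasles am mb H2).
by ring.
Qed.

Lemma circ_splity P Q a b c m d : c <= m -> m <= d -> a <= b ->
  cont_on (Q a) c d -> cont_on (Q b) c d ->
  circ P Q a b c d = circ P Q a b c m + circ P Q a b m d.
Proof.
move=> am mb cd H1 H2; rewrite /circ (seg_int_chasles am mb H1) (seg_int_chasles am mb H2).
by ring.
Qed.

(** Comparison with the first-order Taylor polynomial at (x, y), an affine closed form of
    circulation 0. The error is e/2 times the half-perimeter, integrated over the perimeter: the
    square of the size is what balances the factor 4 lost when a rectangle is cut into quarters. *)
Lemma circ_small P Q x y (e : R) : closed_at P Q x y -> 0 < e ->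
  exists2 dl : R, 0 < dl & forall a b c d, a <= x <= b -> c <= y <= d ->
    (b - a) + (d - c) < dl -> circ_cont P Q a b c d ->
    `|circ P Q a b c d| <= e * ((b - a) + (d - c)) ^+ 2.
Proof.
move=> [p [s [q H]]] e0; have [|dl dl0 Hd] := H (e / 2); first by rewrite divr_gt0.
exists dl => // a b c d /andP[ax xb] /andP[cy yd] sz cc.
have ab : a <= b by lra.
have cd : c <= d by lra.
have [ca c0] := @circ_affine (P x y - p * x - s * y) p s (Q x y - s * x - q * y) q a b c d ab cd.
have := @circ_dist P Q _ _ a b c d (e / 2 * ((b - a) + (d - c))) ab cd cc ca.
rewrite c0 subr0 => /(_ _)/le_trans; apply; last by apply: eqR_le; field.
move=> x' y' /andP[ax' xb'] /andP[cy' yd'] _.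
have hx : `|x' - x| <= b - a by rewrite ler_norml; apply/andP; split; lra.
have hy : `|y' - y| <= d - c by rewrite ler_norml; apply/andP; split; lra.
have [||h1 h2] := Hd (x' - x) (y' - y); [lra|lra|].
rewrite [x + _]addrC [y + _]addrC !subrK in h1 h2.
split.
- apply: le_trans; last by apply: ler_wpM2l (lerD hx hy); lra.
  by apply: le_trans h1; apply: eqR_le; congr `|_|; ring.
- apply: le_trans; last by apply: ler_wpM2l (lerD hx hy); lra.
  by apply: le_trans h2; apply: eqR_le; congr `|_|; ring.
Qed.

Lemma nested_itv (u v : nat -> R) : (forall n, u n <= u n.+1) ->
  (forall n, v n.+1 <= v n) -> (forall n, u n <= v n) ->
  exists x, forall n, u n <= x <= v n.
Proof.
move=> uS vS uv.
have um : {homo u : m n / (m <= n)%N >-> m <= n} by exact/nondecreasing_seqP.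
have vm : {homo v : m n / (m <= n)%N >-> m >= n} by exact/nonincreasing_seqP.
have uvm m n : u m <= v n.
  apply: le_trans (um _ _ (leq_maxl m n)) _.
  by apply: le_trans (uv _) _; apply: vm; exact: leq_maxr.
exists (sup (range u)) => n; apply/andP; split.
  by apply: ub_le_sup; [exists (v 0) => _ [m _ <-]|exists n].
by apply: ge_sup; [exists (u 0), 0%N|move=> _ [m _ <-]].
Qed.

(** Dissection: a rectangle whose circulation exceeds e L^2, with L its half-perimeter, has a
    quarter with the same property. The nested quarters shrink to a point, where [circ_small]
    contradicts the lower bound. *)
Theorem goursat P Q a b c d : a <= b -> c <= d -> closed_on P Q a b c d ->
  circ P Q a b c d = 0.
Proof.
move=> ab cd H; apply/eqP; rewrite -normr_eq0; apply/eqP/le_anti.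
rewrite normr_ge0 andbT leNgt; apply/negP => pos.
pose L (r : R * R * (R * R)) := (r.1.2 - r.1.1) + (r.2.2 - r.2.1).
pose I (r : R * R * (R * R)) := circ P Q r.1.1 r.1.2 r.2.1 r.2.2.
pose ok (r : R * R * (R * R)) := [/\ a <= r.1.1, r.1.1 <= r.1.2, r.1.2 <= b &
   [/\ c <= r.2.1, r.2.1 <= r.2.2 & r.2.2 <= d]].
pose r0 : R * R * (R * R) := ((a, b), (c, d)).
have L0 : 0 <= L r0 by rewrite /L/=; lra.
(* The [+ 1] in the witness keeps the denominator positive even for a rectangle reduced to a
   point. *)
have [e e0 bad0] : exists2 e, 0 < e & e * L r0 ^+ 2 < `|I r0|.
  exists (`|I r0| / (L r0 ^+ 2 + 1) / 2).
    by rewrite !divr_gt0// ltr_wpDl// exprn_ge0.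
  set w := L r0 ^+ 2; have w0 : 0 <= w by rewrite exprn_ge0.
  set i := `|I r0|; have i0 : 0 < i by [].
  have -> : i / (w + 1) / 2 * w = i * (w / ((w + 1) * 2)) by field; lra.
  by rewrite gtr_pMr// ltr_pdivrMr; lra.
pose bad r := ok r /\ e * L r ^+ 2 < `|I r|.
pose sub (r r' : R * R * (R * R)) := [/\ r.1.1 <= r'.1.1, r'.1.2 <= r.1.2, r.2.1 <= r'.2.1, r'.2.2 <= r.2.2
   & L r' = L r / 2].
have step r : bad r -> exists r', bad r' /\ sub r r'.
  move: r => [[p q] [s t]] [[/= ap pq qb [cs st td]] bd].
  pose m := (p + q) / 2; pose n := (s + t) / 2.
  have okr u v w z : p <= u -> u <= v -> v <= q -> s <= w -> w <= z -> z <= t ->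
     circ_cont P Q u v w z.
    move=> *; apply: closed_on_circ_cont => // x y /andP[? ?] /andP[? ?].
    by apply: H; apply/andP; split; lra.
  have [pm mq sn nt] : [/\ p <= m, m <= q, s <= n & n <= t] by rewrite /m /n; split; lra.
  have [h1 h2 h3 h4] := okr p q s t (lexx _) pq (lexx _) (lexx _) st (lexx _).
  have [_ k2 _ k4] := okr p m s t (lexx _) pm mq (lexx _) st (lexx _).
  have [_ l2 _ l4] := okr m q s t pm mq (lexx _) (lexx _) st (lexx _).
  have E : I ((p, q), (s, t)) = I ((p, m), (s, n)) + I ((p, m), (n, t)) +
     (I ((m, q), (s, n)) + I ((m, q), (n, t))).
    rewrite /I/= (circ_splitx Q pm mq st h1 h3).
    by rewrite (circ_splity P sn nt pm k4 k2) (circ_splity P sn nt mq l4 l2).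
  (* If no quarter were bad, the four bounds e (L/2)^2 would add up to e L^2. *)
  apply: contrapT => nex.
  have small r' : ok r' -> sub ((p, q), (s, t)) r' -> `|I r'| <= e * (L ((p, q), (s, t)) / 2) ^+ 2.
    move=> okr' sb; rewrite leNgt; apply/negP => lt; apply: nex; exists r'; split => //.
    by split => //; have [_ _ _ _ ->] := sb.
  have s1 := small ((p, m), (s, n)) ltac:(by split => //=; try split => //; lra)
     ltac:(by split => //=; rewrite /L/= /m /n; field).
  have s2 := small ((p, m), (n, t)) ltac:(by split => //=; try split => //; lra)
     ltac:(by split => //=; rewrite /L/= /m /n; field).
  have s3 := small ((m, q), (s, n)) ltac:(by split => //=; try split => //; lra)
     ltac:(by split => //=; rewrite /L/= /m /n; field).
  have s4 := small ((m, q), (n, t)) ltac:(by split => //=; try split => //; lra)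
     ltac:(by split => //=; rewrite /L/= /m /n; field).
  move: bd; rewrite E ltNge => /negP; apply.
  apply: le_trans (ler_normD _ _) _.
  apply: le_trans (lerD (ler_normD _ _) (ler_normD _ _)) _.
  apply: le_trans (lerD (lerD s1 s2) (lerD s3 s4)) _.
  by apply: eqR_le; field.
have [f fP] : {f & forall r, bad r -> bad (f r) /\ sub r (f r)}.
  by apply: (@choice _ _ (fun r r' => bad r -> bad r' /\ sub r r')) => r;
    have [/step[r' ?]|nb] := pselect (bad r); [exists r'|exists r].
pose S n := iter n f r0.
have Sbad n : bad (S n).
  elim: n => [|n IH /=]; last by have [] := fP _ IH.
  by split => //; split => //.
have Ssub n : sub (S n) (S n.+1) by have [] := fP _ (Sbad n).
have LS n : L (S n) = L r0 / 2 ^+ n.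
  elim: n => [|n IH]; first by rewrite expr0 divr1.
  by have [_ _ _ _ ->] := Ssub n; rewrite IH exprS; field; rewrite expf_neq0.
have [x xP] : exists x, forall n, (S n).1.1 <= x <= (S n).1.2.
  by apply: nested_itv => n; [have [] := Ssub n|have [] := Ssub n|have [[]] := Sbad n].
have [y yP] : exists x, forall n, (S n).2.1 <= x <= (S n).2.2.
  by apply: nested_itv => n; [have [] := Ssub n|have [] := Ssub n|have [[? ? ? []]] := Sbad n].
have [|dl dl0 Hd] := @circ_small P Q x y e _ e0.
  by apply: H; [exact: (xP 0%N)|exact: (yP 0%N)].
have [n Ln] : exists n, L (S n) < dl.
  have : (fun n => L r0 / 2 ^+ n) @ \oo --> (0 : R).
    rewrite -[X in _ --> X](mulr0 (L r0)); apply: cvgMr.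
    by under eq_fun do rewrite -exprVn; apply: cvg_expr; rewrite ger0_norm ?invr_ge0//; lra.
  move/cvgrPdist_lt => /(_ _ dl0)[n _ /(_ n (leqnn n))] /=.
  rewrite sub0r normrN ger0_norm; first by rewrite -LS; exists n.
  by rewrite divr_ge0// exprn_ge0.
have [[? ? ? [? ? ?]] bd] := Sbad n.
have := Hd _ _ _ _ (xP n) (yP n) Ln.
move=> /(_ _)/le_lt_trans /(_ bd); rewrite ltxx => F; apply: notF; apply: F.
apply: closed_on_circ_cont => // x' y' /andP[? ?] /andP[? ?].
by apply: H; apply/andP; split; lra.
Qed.

End Goursat.

(** * Goursat's lemma with a bounded singularity *)

Section GoursatPunctured.
Variable R : realType.
Implicit Types (P Q : R -> R -> R) (a b c d x y M : R).

Lemma circ_cont0 a b c d : circ_cont (fun=> fun=> (0 : R)) (fun=> fun=> 0) a b c d.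
Proof. by split; exact: cont_on_cst. Qed.

Lemma circ0 a b c d : a <= b -> c <= d -> circ (fun=> fun=> (0 : R)) (fun=> fun=> 0) a b c d = 0.
Proof. by move=> ab cd; rewrite /circ !seg_int_cst// !mul0r !subr0 addr0. Qed.

(** The circulation equals the one around a small square centred at the puncture, and the latter is
    at most M times twice its perimeter, which tends to 0. *)
Lemma goursat_punctured P Q a b c d p q M (dl : R) :
  a < p < b -> c < q < d ->
  (forall x y, a <= x <= b -> c <= y <= d -> (x != p) || (y != q) ->
    closed_at P Q x y) ->
  0 < dl ->
  (forall x y, `|x - p| < dl -> `|y - q| < dl -> (x != p) || (y != q) ->
    `|P x y| <= M /\ `|Q x y| <= M) ->
  circ P Q a b c d = 0.
Proof.
move=> /andP[ap pb] /andP[cq qd] H dl0 HM.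
have cP y : c <= y <= d -> y != q -> cont_on (P ^~ y) a b.
  move=> yd yq x xab; apply: (@closed_at_contP1 _ _ Q); apply: H => //.
  by rewrite yq orbT.
have cQ x : a <= x <= b -> x != p -> cont_on (Q x) c d.
  move=> yd yq y xab; apply: (@closed_at_contQ2 _ P); apply: H => //.
  by rewrite yq.
(* Two vertical cuts, then two horizontal cuts of the middle strip, isolate the square; Goursat's
   lemma kills the four rectangles that avoid (p, q). *)
have key t : 0 < t -> t < p - a -> t < b - p -> t < q - c -> t < d - q ->
    circ P Q a b c d = circ P Q (p - t) (p + t) (q - t) (q + t).
  move=> t0 t1 t2 t3 t4.
  rewrite (@circ_splitx _ _ _ a (p - t) b); try lra; last 2 first.
  - by apply: cP; [apply/andP; split|rewrite lt_eqF]; lra.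
  - by apply: cP; [apply/andP; split|rewrite gt_eqF]; lra.
  rewrite (@circ_splitx _ _ _ (p - t) (p + t) b); try lra; last 2 first.
  - by apply: (@cont_on_sub _ _ a b); [lra|lra|]; apply: cP; [apply/andP; split|rewrite lt_eqF]; lra.
  - by apply: (@cont_on_sub _ _ a b); [lra|lra|]; apply: cP; [apply/andP; split|rewrite gt_eqF]; lra.
  rewrite (@circ_splity _ _ _ (p - t) (p + t) c (q - t) d); try lra; last 2 first.
  - by apply: cQ; [apply/andP; split|rewrite lt_eqF]; lra.
  - by apply: cQ; [apply/andP; split|rewrite gt_eqF]; lra.
  rewrite (@circ_splity _ _ _ (p - t) (p + t) (q - t) (q + t) d); try lra; last 2 first.
  - by apply: (@cont_on_sub _ _ c d); [lra|lra|]; apply: cQ; [apply/andP; split|rewrite lt_eqF]; lra.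
  - by apply: (@cont_on_sub _ _ c d); [lra|lra|]; apply: cQ; [apply/andP; split|rewrite gt_eqF]; lra.
  rewrite (@goursat _ P Q a (p - t) c d); try lra; last first.
    move=> x y /andP[? ?] /andP[? ?]; apply: H; try (apply/andP; split; lra).
    by rewrite lt_eqF//; lra.
  rewrite (@goursat _ P Q (p + t) b c d); try lra; last first.
    move=> x y /andP[? ?] /andP[? ?]; apply: H; try (apply/andP; split; lra).
    by rewrite gt_eqF//; lra.
  rewrite (@goursat _ P Q (p - t) (p + t) c (q - t)); try lra; last first.
    move=> x y /andP[? ?] /andP[? ?]; apply: H; try (apply/andP; split; lra).
    by rewrite orbC lt_eqF//; lra.
  rewrite (@goursat _ P Q (p - t) (p + t) (q + t) d); try lra; last first.
    move=> x y /andP[? ?] /andP[? ?]; apply: H; try (apply/andP; split; lra).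
    by rewrite orbC gt_eqF//; lra.
have M0 : 0 <= M.
  have h1 : `|p + dl / 2 - p| < dl by rewrite addrAC subrr add0r gtr0_norm; lra.
  have h2 : `|q - q| < dl by rewrite subrr normr0.
  have [|/(le_trans (normr_ge0 _))//] := HM _ _ h1 h2.
  by rewrite gt_eqF//; lra.
apply/eqP; rewrite -normr_le0; apply/ler_addgt0Pr => e e0; rewrite add0r.
pose mm := Num.min (Num.min (p - a) (b - p)) (Num.min (q - c) (d - q)).
have mm0 : 0 < mm by rewrite /mm !lt_min; apply/andP; split; apply/andP; split; lra.
(* [mm] keeps the square inside the rectangle, [dl] keeps it where the bound M holds, and the last
   term makes the estimate 2 M (4 t) = 8 M t at most e. The final halving makes the inequalities
   strict. *)
pose t := Num.min (Num.min mm dl) (e / (8 * M + 1)) / 2.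
have eM0 : 0 < e / (8 * M + 1) by rewrite divr_gt0//; lra.
have t0 : 0 < t.
  rewrite /t divr_gt0//; move: mm0; move: (mm) => m0 m00.
  by rewrite !lt_min m00 dl0 eM0.
have : 2 * t <= Num.min (Num.min mm dl) (e / (8 * M + 1)) by rewrite /t; lra.
rewrite !le_min => /andP[/andP[/andP[/andP[t1 t2] /andP[t3 t4]] t5] t6].
have bne x y : on_boundary (p - t) (p + t) (q - t) (q + t) x y -> (x != p) || (y != q).
  by apply: boundary_neq; apply/andP; split; lra.
rewrite (key t); try lra.
have := @circ_dist _ P Q (fun=> fun=> 0) (fun=> fun=> 0) (p - t) (p + t) (q - t) (q + t) M.
rewrite circ0; try lra.
rewrite subr0 => /(_ _ _ _ _ _)/le_trans; apply; try lra.
- apply: closed_boundary_circ_cont; [lra|lra|move=> x y /andP[x1 x2] /andP[y1 y2] bd].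
  apply: H; [by apply/andP; split; lra|by apply/andP; split; lra|exact: bne bd].
- exact: circ_cont0.
- move=> x y /andP[x1 x2] /andP[y1 y2] bd; rewrite !subr0; apply: HM.
  + by rewrite ltr_norml; apply/andP; split; lra.
  + by rewrite ltr_norml; apply/andP; split; lra.
  + exact: bne bd.
have : 2 * t * (8 * M + 1) <= e by rewrite -ler_pdivlMr//; lra.
have tM : 0 <= t * M by rewrite mulr_ge0// ltW.
have -> : 2 * M * (p + t - (p - t) + (q + t - (q - t))) = 8 * (t * M) by ring.
have -> : 2 * t * (8 * M + 1) = 16 * (t * M) + 2 * t by ring.
lra.
Qed.

Lemma circB P Q P' Q' a b c d : circ_cont P Q a b c d -> circ_cont P' Q' a b c d ->
  circ (fun x y => P x y - P' x y) (fun x y => Q x y - Q' x y) a b c d =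
  circ P Q a b c d - circ P' Q' a b c d.
Proof.
by move=> [? ? ? ?] [? ? ? ?]; rewrite /circ !seg_intB//; ring.
Qed.

Lemma circ_contB P Q P' Q' a b c d : circ_cont P Q a b c d -> circ_cont P' Q' a b c d ->
  circ_cont (fun x y => P x y - P' x y) (fun x y => Q x y - Q' x y) a b c d.
Proof. by move=> [? ? ? ?] [? ? ? ?]; split; exact: cont_onB. Qed.

End GoursatPunctured.

(** * The real-valued modulus of a complex number *)

Section ComplexNorm.
Variable R : rcfType.
Import Normc.
Implicit Types z w : R[i].

Lemma normc_ge0 z : 0 <= normc z.
Proof. by case: z => a b; exact: sqrtr_ge0. Qed.

Lemma normcD_le z w : normc (z + w) <= normc z + normc w.
Proof. exact: (@le_normcD R z w). Qed.

Lemma normcB_sym z w : normc (z - w) = normc (w - z).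
Proof. by rewrite -opprB (normcN (w - z)). Qed.

Lemma normcB_le z w : normc (z - w) <= normc z + normc w.
Proof. by rewrite (le_trans (normcD_le _ _))// (normcN w). Qed.

Lemma normr_Re_le z : `|complex.Re z| <= normc z.
Proof.
case: z => a b /=; rewrite -sqrtr_sqr ler_sqrt ?addr_ge0 ?sqr_ge0//.
by rewrite lerDl sqr_ge0.
Qed.

Lemma normr_Im_le z : `|complex.Im z| <= normc z.
Proof.
case: z => a b /=; rewrite -sqrtr_sqr ler_sqrt ?addr_ge0 ?sqr_ge0//.
by rewrite lerDr sqr_ge0.
Qed.

Lemma ReB z w : complex.Re (z - w) = complex.Re z - complex.Re w.
Proof. by case: z w => [? ?] [? ?]. Qed.

Lemma ImB z w : complex.Im (z - w) = complex.Im z - complex.Im w.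
Proof. by case: z w => [? ?] [? ?]. Qed.

Lemma normc_real (x : R) : normc (x%:C)%C = `|x|.
Proof. by rewrite /= expr0n addr0 sqrtr_sqr. Qed.

Lemma normc_le_ReIm z : normc z <= `|complex.Re z| + `|complex.Im z|.
Proof.
case: z => a b; have -> : Complex a b = (a%:C)%C + (b%:C)%C * Complex 0 1 by simpc.
apply: le_trans (normcD_le _ _) _; rewrite normcM !normc_real.
have -> : normc (Complex 0 1 : R[i]) = 1 by rewrite /= expr0n expr1n add0r sqrtr1.
by simpc.
Qed.

Lemma normc_gt0 z : (0 < normc z) = (z != 0).
Proof.
rewrite lt_neqAle normc_ge0 andbT eq_sym; congr negb.
by apply/eqP/eqP => [/eq0_normc|->]; rewrite ?normc0.
Qed.

Lemma lec_real z (M : R) : (`|z| <= (M%:C)%C) = (normc z <= M).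
Proof. exact: lecR. Qed.

Lemma ltc_real z (M : R) : (`|z| < (M%:C)%C) = (normc z < M).
Proof. exact: ltcR. Qed.

End ComplexNorm.

(** * Cauchy's estimate as a Lipschitz bound *)

Section CauchyEstimate.
Variable R : realType.
Import Normc.
Implicit Types (g k : R[i] -> R[i]) (z w : R[i]).

Definition cdiff k z := exists l : R[i], forall e : R, 0 < e ->
  exists2 dl : R, 0 < dl & forall h : R[i], normc h < dl ->
    normc (k (z + h) - k z - l * h) <= e * normc h.

Local Notation ImF k := (fun x y => complex.Im (k (Complex x y))).
Local Notation ReF k := (fun x y => complex.Re (k (Complex x y))).

(** For k = u + i v the imaginary part of k dz is v dx + u dy, and it is closed by the
    Cauchy-Riemann equations: with derivative la + i lb, v_x = lb, v_y = u_x = la and u_y = - lb.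
    Only this part of the contour integral is ever used, because the contour integral of the Cauchy
    kernel is purely imaginary. *)
Lemma cdiff_closed_at k x y : cdiff k (Complex x y) ->
  closed_at (ImF k) (ReF k) x y.
Proof.
move=> [[la lb] H]; exists lb, la, (- lb) => e e0.
have [dl dl0 Hd] := H e e0.
exists (dl / 2); first by rewrite divr_gt0.
move=> s t hs ht.
have st : normc (Complex s t) <= `|s| + `|t| by exact: normc_le_ReIm.
have {Hd}Hd : normc (k (Complex (x + s) (y + t)) - k (Complex x y) - Complex la lb * Complex s t)
    <= e * (`|s| + `|t|).
  apply: le_trans (Hd (Complex s t) _) _; first by lra.
  by rewrite ler_pM2l.
move: Hd; case: (k (Complex (x + s) (y + t))) => u v; case: (k (Complex x y)) => u' v'.
simpc => Hd; split.
- by apply: le_trans Hd; apply: le_trans (normr_Im_le _); rewrite /=; apply: eqR_le; congr `|_|; ring.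
- by apply: le_trans Hd; apply: le_trans (normr_Re_le _); rewrite /=; apply: eqR_le; congr `|_|; ring.
Qed.

Lemma cdiff_affine k z (c m : R[i]) : cdiff k z -> cdiff (fun z => (k z - c) * m) z.
Proof.
move=> [l H]; exists (l * m) => e e0.
have m1 : 0 < normc m + 1 by have := normc_ge0 m; lra.
have [|dl dl0 Hd] := H (e / (normc m + 1)); first by rewrite divr_gt0.
exists dl => // h hd.
have -> : (k (z + h) - c) * m - (k z - c) * m - l * m * h =
  (k (z + h) - k z - l * h) * m by ring.
rewrite normcM; apply: le_trans (ler_wpM2r (normc_ge0 _) (Hd h hd)) _.
have -> : e / (normc m + 1) * normc h * normc m =
   (e * normc h) * (normc m / (normc m + 1)) by field; lra.
apply: ler_piMr; first by rewrite mulr_ge0 ?normc_ge0// ltW.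
by rewrite ler_pdivrMr//; lra.
Qed.

Lemma cdiff_quot k z w : cdiff k z -> z != w -> cdiff (fun z => k z / (z - w)) z.
Proof.
move=> [l H] zw; pose D := z - w; pose N := k z.
have D0 : D != 0 by rewrite subr_eq0.
pose d := normc D; have d0 : 0 < d by rewrite normc_gt0.
exists ((l * D - N) / D ^+ 2) => e e0.
pose K := normc (N - l * D).
have K0 : 0 <= K by exact: normc_ge0.
have [|dl dl0 Hd] := H (e * d / 4); first by rewrite divr_gt0// mulr_gt0.
(* With |D + h| >= d/2, this makes the quadratic remainder K |h|^2 / (d^2 |D + h|) at most e |h| /
   2; the tolerance e d / 4 above does the same for the remainder of k. *)
pose m := e * d ^+ 3 / (4 * (K + 1)).
have m0 : 0 < m by rewrite /m divr_gt0 ?mulr_gt0 ?exprn_gt0//; lra.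
exists (Num.min (Num.min dl (d / 2)) m).
  by rewrite !lt_min dl0 m0 divr_gt0.
move=> h; rewrite !lt_min => /andP[/andP[h1 h2] h3].
have Dh : d / 2 <= normc (D + h).
  have := normcB_le (D + h) h; rewrite addrK -/d; lra.
have Dh0 : D + h != 0 by rewrite -normc_gt0; apply: lt_le_trans Dh; rewrite divr_gt0.
have -> : k (z + h) / (z + h - w) - k z / (z - w) - (l * D - N) / D ^+ 2 * h =
   (k (z + h) - k z - l * h) / (D + h) + (N - l * D) * (h * h) / (D * D * (D + h)).
  have -> : z + h - w = D + h by rewrite /D; ring.
  by rewrite -/D -/N; field; rewrite D0 Dh0.
apply: le_trans (normcD_le _ _) _.
rewrite !normcM !normcV !normcM -/K -/d.
have {Hd}Hd := Hd h h1.
have nh := normc_ge0 h.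
have iDh : (normc (D + h))^-1 <= 2 / d.
  by rewrite -[2 / d]invf_div lef_pV2// posrE ?divr_gt0// (lt_le_trans _ Dh)// divr_gt0.
have iDh0 : 0 <= (normc (D + h))^-1 by rewrite invr_ge0 normc_ge0.
have -> : e * normc h = e * normc h / 2 + e * normc h / 2 by field.
apply: lerD.
  apply: le_trans (ler_pM (normc_ge0 _) iDh0 Hd iDh) _.
  by apply: eqR_le; field; lra.
rewrite invfM.
apply: (@le_trans _ _ (K * (normc h * m) * ((d * d)^-1 * (2 / d)))).
  have dd0 : 0 <= d * d by rewrite mulr_ge0 ?(ltW d0).
  apply: ler_pM; rewrite ?mulr_ge0 ?invr_ge0 ?normc_ge0 ?invr_ge0//.
    apply: ler_wpM2l => //; apply: ler_wpM2l => //; exact: ltW.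
  by apply: ler_wpM2l => //; rewrite invr_ge0.
rewrite /m.
have -> : K * (normc h * (e * d ^+ 3 / (4 * (K + 1)))) * ((d * d)^-1 * (2 / d)) =
  (e * normc h / 2) * (K / (K + 1)) by field; lra.
apply: ler_piMr; first by rewrite divr_ge0// mulr_ge0// ltW.
by rewrite ler_pdivrMr//; lra.
Qed.

Lemma cdiff_quot_bounded k w : cdiff k w -> exists M, exists2 dl : R, 0 < dl &
  forall z, z != w -> normc (z - w) < dl -> normc ((k z - k w) / (z - w)) <= M.
Proof.
move=> [l H]; have [dl dl0 Hd] := H 1 ltr01.
exists (normc l + 1), dl => // z zw zd.
have zw0 : 0 < normc (z - w) by rewrite normc_gt0 subr_eq0.
rewrite normcM normcV ler_pdivrMr//.
have := Hd _ zd; rewrite [w + _]addrC subrK => hh.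
have -> : k z - k w = (k z - k w - l * (z - w)) + l * (z - w) by ring.
apply: le_trans (normcD_le _ _) _; rewrite normcM mulrDl; lra.
Qed.

(** The singularity at w is removable: the difference quotient stays bounded near w by
    differentiability, which is what the punctured form of Goursat's lemma asks. *)
Lemma circ_quot0 k (w0 w1 a b c d : R) : a < w0 < b -> c < w1 < d ->
  (forall x y, a <= x <= b -> c <= y <= d -> cdiff k (Complex x y)) ->
  let q := fun z => (k z - k (Complex w0 w1)) / (z - Complex w0 w1) in
  circ_cont (ImF q) (ReF q) a b c d /\ circ (ImF q) (ReF q) a b c d = 0.
Proof.
move=> abw cdw kd q; move: (abw) (cdw) => /andP[aw wb] /andP[cw wd].
pose w := Complex w0 w1.
have cl x y : a <= x <= b -> c <= y <= d -> (x != w0) || (y != w1) ->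
    closed_at (ImF q) (ReF q) x y.
  move=> xab ycd ne; apply: cdiff_closed_at.
  apply: (@cdiff_quot (fun z => k z - k w)).
    have [l lP] := cdiff_affine (k w) 1 (kd x y xab ycd); exists l => e /lP[dl dl0 Hd].
    by exists dl => // h /Hd; rewrite !mulr1.
  by rewrite eq_complex /= negb_and.
split.
  apply: closed_boundary_circ_cont => [||x y xab ycd bd]; [lra|lra|].
  by apply: cl => //; exact: boundary_neq abw cdw bd.
have [|M [dl dl0 Hd]] := @cdiff_quot_bounded k w.
  by apply: kd; apply/andP; split; lra.
apply: (@goursat_punctured _ _ _ a b c d w0 w1 M (dl / 2)) => //; first by rewrite divr_gt0.
move=> x y hx hy ne.
have hq : normc (q (Complex x y)) <= M.
  apply: Hd; first by rewrite eq_complex /= negb_and.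
  apply: le_lt_trans (normc_le_ReIm _) _ => /=; lra.
split; first exact: le_trans (normr_Im_le _) hq.
exact: le_trans (normr_Re_le _) hq.
Qed.

(* The circulation is 2 pi; bounding the integrand on each side by its minimum gives 4. *)
Lemma circ_cauchy_kernel (x0 y0 r : R) : 0 < r ->
  let q := fun z => (z - Complex x0 y0)^-1 in
  let a := x0 - r in let b := x0 + r in let c := y0 - r in let d := y0 + r in
  circ_cont (ImF q) (ReF q) a b c d /\ 4 <= circ (ImF q) (ReF q) a b c d.
Proof.
move=> r0 q a b c d.
have cc : circ_cont (ImF q) (ReF q) a b c d.
  have cl x y : (x != x0) || (y != y0) -> closed_at (ImF q) (ReF q) x y.
    move=> ne; apply: cdiff_closed_at.
    have [l lP] : cdiff (fun z => (fun=> 1) z / (z - Complex x0 y0)) (Complex x y).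
      apply: (@cdiff_quot (fun=> 1)).
        by exists 0 => e e0; exists 1 => // h _; rewrite subrr mul0r subrr normc0 mulr_ge0 ?normc_ge0// ltW.
      by rewrite eq_complex /= negb_and.
    exists l => e /lP[dl dl0 Hd].
    by exists dl => // h /Hd; rewrite !mul1r.
  apply: closed_boundary_circ_cont => [||x y _ _ bd]; rewrite /a /b /c /d; [lra|lra|].
  by apply: cl; apply: boundary_neq bd; apply/andP; split; rewrite /a /b /c /d; lra.
split => //; have [c1 c2 c3 c4] := cc.
have qE x y : q (Complex x y) = Complex ((x - x0) / ((x - x0) ^+ 2 + (y - y0) ^+ 2))
   (- ((y - y0) / ((x - x0) ^+ 2 + (y - y0) ^+ 2))) by [].
have pos (u : R) : - r <= u -> u <= r -> (2 * r)^-1 <= r / (u ^+ 2 + r ^+ 2).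
  move=> u1 u2.
  have r2 : 0 < r ^+ 2 by rewrite exprn_gt0.
  have u0 : 0 <= u ^+ 2 by rewrite sqr_ge0.
  have ur : u ^+ 2 <= r ^+ 2 by rewrite -subr_ge0 subr_sqr mulr_ge0//; lra.
  rewrite ler_pdivlMr; last lra.
  rewrite ler_pdivrMl; last lra.
  by rewrite -mulrA -expr2; lra.
have one : 1 = (2 * r)^-1 * (2 * r) by rewrite mulVf//; lra.
have oneN : - 1 = - (2 * r)^-1 * (2 * r) by rewrite mulNr mulVf//; lra.
have e1 : 1 <= seg_int (fun x => ImF q x c) a b.
  have -> : 1 = seg_int (fun=> (2 * r)^-1) a b.
    by rewrite seg_int_cst /a /b; [rewrite {1}one; congr (_ * _); ring|lra].
  apply: le_seg_int => //; first exact: cont_on_cst.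
  move=> x; rewrite /a /b => /andP[xa xb]; rewrite qE /= /c.
  have -> : - ((y0 - r - y0) / ((x - x0) ^+ 2 + (y0 - r - y0) ^+ 2)) = r / ((x - x0) ^+ 2 + r ^+ 2).
    have -> : y0 - r - y0 = - r by ring.
    by rewrite sqrrN mulNr opprK.
  by apply: pos; lra.
have e2 : 1 <= seg_int (ReF q b) c d.
  have -> : 1 = seg_int (fun=> (2 * r)^-1) c d.
    by rewrite seg_int_cst /c /d; [rewrite {1}one; congr (_ * _); ring|lra].
  apply: le_seg_int => //; first exact: cont_on_cst.
  move=> y; rewrite /c /d => /andP[ya yb]; rewrite qE /= /b.
  have -> : x0 + r - x0 = r by ring.
  by rewrite [r ^+ 2 + _]addrC; apply: pos; lra.
have e3 : seg_int (fun x => ImF q x d) a b <= - 1.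
  have -> : - 1 = seg_int (fun=> - (2 * r)^-1) a b.
    by rewrite seg_int_cst /a /b; [rewrite {1}oneN; congr (_ * _); ring|lra].
  apply: le_seg_int => //; first exact: cont_on_cst.
  move=> x; rewrite /a /b => /andP[xa xb]; rewrite qE /= /d lerN2.
  have -> : y0 + r - y0 = r by ring.
  by apply: pos; lra.
have e4 : seg_int (ReF q a) c d <= - 1.
  have -> : - 1 = seg_int (fun=> - (2 * r)^-1) c d.
    by rewrite seg_int_cst /c /d; [rewrite {1}oneN; congr (_ * _); ring|lra].
  apply: le_seg_int => //; first exact: cont_on_cst.
  move=> y; rewrite /c /d => /andP[ya yb]; rewrite qE /= /a.
  have -> : x0 - r - x0 = - r by ring.
  by rewrite sqrrN mulNr lerN2 [r ^+ 2 + _]addrC; apply: pos; lra.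
by rewrite /circ; lra.
Qed.

(* With z and w the two points, Goursat's lemma is applied to
   k(u)/(u - w) - (k(u) - 1)/(u - z) = 1/(u - z) + k(u) (w - z)/((u - z)(u - w)). *)
Lemma cauchy_lipschitz_normalized k (x0 y0 x1 y1 r K : R) : 0 < r ->
  `|x1 - x0| <= r / 2 -> `|y1 - y0| <= r / 2 ->
  (forall x y, `|x - x0| <= r -> `|y - y0| <= r ->
    cdiff k (Complex x y) /\ normc (k (Complex x y)) <= K) ->
  k (Complex x0 y0) = 1 -> k (Complex x1 y1) = 0 ->
  r <= 4 * K * normc (Complex x1 y1 - Complex x0 y0).
Proof.
move=> r0 hx hy H kz kw.
set z := Complex x0 y0 in kz *; set w := Complex x1 y1 in kw *.
pose a := x0 - r; pose b := x0 + r; pose c := y0 - r; pose d := y0 + r.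
move: (hx) (hy); rewrite !ler_norml => /andP[hx1 hx2] /andP[hy1 hy2].
have inab x : a <= x <= b -> `|x - x0| <= r.
  by rewrite /a /b => /andP[? ?]; rewrite ler_norml; apply/andP; split; lra.
have incd x : c <= x <= d -> `|x - y0| <= r.
  by rewrite /c /d => /andP[? ?]; rewrite ler_norml; apply/andP; split; lra.
have kd x y : a <= x <= b -> c <= y <= d -> cdiff k (Complex x y).
  by move=> /inab xx /incd yy; have [] := H x y xx yy.
have [cz iz] := @circ_quot0 k x0 y0 a b c d ltac:(by rewrite /a /b; apply/andP; split; lra)
   ltac:(by rewrite /c /d; apply/andP; split; lra) kd.
have [cw iw] := @circ_quot0 k x1 y1 a b c d ltac:(by rewrite /a /b; apply/andP; split; lra)
   ltac:(by rewrite /c /d; apply/andP; split; lra) kd.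
rewrite -/z kz in cz iz; rewrite -/w kw in cw iw.
have [c1 i1] := @circ_cauchy_kernel x0 y0 r r0.
rewrite -/z -/a -/b -/c -/d in c1 i1.
have K0 : 0 <= K.
  have [||_] := H x0 y0; rewrite ?subrr ?normr0 ?(ltW r0)//.
  exact: le_trans (normc_ge0 _).
(* On the boundary |u - z| >= r, and |u - w| >= r/2 since w lies in the concentric square of half
   the size. The perimeter being 8 r, the inequality 4 <= 8 r m is the claim. *)
pose m := K * normc (w - z) * ((r * (r / 2))^-1).
have := @circ_dist _ _ _ _ _ a b c d m _ _ (circ_contB cw cz) c1.
rewrite circB// iw iz subr0 => hm; suff : 4 <= 2 * m * (b - a + (d - c)).
  have -> : 2 * m * (b - a + (d - c)) = 16 * K * normc (w - z) / r.
    by rewrite /m /a /b /c /d; field; lra.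
  by rewrite ler_pdivlMr//; lra.
apply: le_trans (hm _ _ _); rewrite ?sub0r ?normrN.
- by apply: le_trans i1 _; exact: ler_norm.
- by rewrite /a /b; lra.
- by rewrite /c /d; lra.
move=> x y xab ycd bd; pose u := Complex x y.
have uz : r <= normc (u - z).
  rewrite /u /z; case/or4P: bd => /eqP ->.
  - by apply: le_trans (normr_Re_le _); rewrite /= /a addrAC subrr add0r normrN gtr0_norm.
  - by apply: le_trans (normr_Re_le _); rewrite /= /b addrAC subrr add0r gtr0_norm.
  - by apply: le_trans (normr_Im_le _); rewrite /= /c addrAC subrr add0r normrN gtr0_norm.
  - by apply: le_trans (normr_Im_le _); rewrite /= /d addrAC subrr add0r gtr0_norm.
have uw : r / 2 <= normc (u - w).
  rewrite /u /w; case/or4P: bd => /eqP ->.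
  - apply: le_trans (normr_Re_le _); rewrite /= /a ler0_norm; lra.
  - apply: le_trans (normr_Re_le _); rewrite /= /b ger0_norm; lra.
  - apply: le_trans (normr_Im_le _); rewrite /= /c ler0_norm; lra.
  - apply: le_trans (normr_Im_le _); rewrite /= /d ger0_norm; lra.
have uz0 : u - z != 0 by rewrite -normc_gt0; lra.
have uw0 : u - w != 0 by rewrite -normc_gt0; lra.
have E : (k u - 0) / (u - w) - (k u - 1) / (u - z) - (u - z)^-1 =
    k u * (w - z) / ((u - z) * (u - w)) by field; rewrite uz0 uw0.
have bound : normc ((k u - 0) / (u - w) - (k u - 1) / (u - z) - (u - z)^-1) <= m.
  rewrite E normcM normcV normcM normcM /m.
  apply: ler_pM; rewrite ?mulr_ge0 ?invr_ge0 ?mulr_ge0 ?normc_ge0//.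
    apply: ler_wpM2r; first exact: normc_ge0.
    by have [] := H x y (inab _ xab) (incd _ ycd).
  rewrite lef_pV2 ?posrE ?mulr_gt0//; try lra.
  by apply: ler_pM => //; lra.
split.
- by apply: le_trans (le_trans (normr_Im_le _) bound); rewrite !ImB.
- by apply: le_trans (le_trans (normr_Re_le _) bound); rewrite !ReB.
Qed.

(** Normalizing g to (g - g(w)) / (g(z) - g(w)), which is 0 at w, 1 at z and bounded by 2 M / |g(z)
    - g(w)|, turns the lower bound on |w - z| of the previous lemma into an upper bound on |g(z) -
    g(w)|. *)
Theorem cauchy_lipschitz g (x0 y0 x1 y1 r M : R) : 0 < r ->
  `|x1 - x0| <= r / 2 -> `|y1 - y0| <= r / 2 ->
  (forall x y, `|x - x0| <= r -> `|y - y0| <= r ->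
    cdiff g (Complex x y) /\ normc (g (Complex x y)) <= M) ->
  normc (g (Complex x1 y1) - g (Complex x0 y0)) <=
    8 * M / r * normc (Complex x1 y1 - Complex x0 y0).
Proof.
move=> r0 hx hy H.
set z := Complex x0 y0; set w := Complex x1 y1.
have gzM : normc (g z) <= M by have [] := H x0 y0; rewrite ?subrr ?normr0 ?(ltW r0)//.
have gwM : normc (g w) <= M by have [] := H x1 y1; lra.
have M0 : 0 <= M by apply: le_trans gzM; exact: normc_ge0.
have [e0|ne0] := eqVneq (g z) (g w).
  rewrite e0 subrr normc0 mulr_ge0 ?normc_ge0// divr_ge0 ?mulr_ge0// ltW//.
pose D := g z - g w; have D0 : D != 0 by rewrite subr_eq0.
have nD0 : 0 < normc D by rewrite normc_gt0.
have := @cauchy_lipschitz_normalized (fun u => (g u - g w) * D^-1) x0 y0 x1 y1 r (2 * M / normc D) r0 hx hy.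
rewrite -/z -/w => hm.
have {hm} : r <= 4 * (2 * M / normc D) * normc (w - z).
  apply: hm.
  - move=> x y xx yy; have [dg bg] := H x y xx yy; split; first exact: cdiff_affine.
    rewrite normcM normcV; apply: ler_wpM2r; first by rewrite invr_ge0 normc_ge0.
    by apply: le_trans (normcB_le _ _) _; lra.
  - by rewrite mulfV.
  - by rewrite subrr mul0r.
rewrite (normcB_sym (g w)) -/D.
have -> : 4 * (2 * M / normc D) * normc (w - z) = 8 * M * normc (w - z) / normc D by field; lra.
rewrite ler_pdivlMr// => h.
have -> : 8 * M / r * normc (w - z) = 8 * M * normc (w - z) / r by field; lra.
by rewrite ler_pdivlMr// mulrC.
Qed.

End CauchyEstimate.

(** * Holomorphic functions of two variables *)

Section HolomorphicTwo.
Variable R : realType.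
Import Normc.
Implicit Types (g h : R[i] * R[i] -> R[i]) (z w : R[i] * R[i]).

Definition hol_at g z := exists l1 l2 : R[i], forall e : R, 0 < e ->
  exists2 dl : R, 0 < dl & forall h1 h2 : R[i], normc h1 < dl -> normc h2 < dl ->
    normc (g (z.1 + h1, z.2 + h2) - g z - (l1 * h1 + l2 * h2)) <=
      e * (normc h1 + normc h2).

Lemma hol_at_cst c z : hol_at (fun=> c) z.
Proof.
exists 0, 0 => e e0; exists 1 => // h1 h2 _ _.
by rewrite subrr !mul0r addr0 subrr normc0 mulr_ge0 ?addr_ge0 ?normc_ge0// ltW.
Qed.

Lemma hol_at_fst z : hol_at fst z.
Proof.
exists 1, 0 => e e0; exists 1 => // h1 h2 _ _ /=.
have -> : z.1 + h1 - z.1 - (1 * h1 + 0 * h2) = 0 by ring.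
by rewrite normc0 mulr_ge0 ?addr_ge0 ?normc_ge0// ltW.
Qed.

Lemma hol_at_snd z : hol_at snd z.
Proof.
exists 0, 1 => e e0; exists 1 => // h1 h2 _ _ /=.
have -> : z.2 + h2 - z.2 - (0 * h1 + 1 * h2) = 0 by ring.
by rewrite normc0 mulr_ge0 ?addr_ge0 ?normc_ge0// ltW.
Qed.

Lemma hol_atD g h z : hol_at g z -> hol_at h z -> hol_at (fun z => g z + h z) z.
Proof.
move=> [l1 [l2 Hg]] [m1 [m2 Hh]]; exists (l1 + m1), (l2 + m2) => e e0.
have e20 : 0 < e / 2 by rewrite divr_gt0.
have [d1 d10 H1] := Hg _ e20; have [d2 d20 H2] := Hh _ e20.
exists (Num.min d1 d2); first by rewrite lt_min d10.
move=> h1 h2; rewrite !lt_min => /andP[a1 a2] /andP[b1 b2].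
have := H1 h1 h2 a1 b1; have := H2 h1 h2 a2 b2 => k2 k1.
set X := normc h1 + normc h2 in k1 k2 *.
have -> : e * X = e / 2 * X + e / 2 * X by field.
apply: le_trans (lerD k1 k2); apply: le_trans (normcD_le _ _).
by apply: eqR_le; congr normc; ring.
Qed.

(** Chain rule. [A] bounds the growth of the inner increments, [B] the size of the outer
    differential; the error e is shared equally between the outer remainder and the image of the
    inner remainders. *)
Lemma hol_at_comp g h1 h2 z : hol_at h1 z -> hol_at h2 z ->
  hol_at g (h1 z, h2 z) -> hol_at (fun z => g (h1 z, h2 z)) z.
Proof.
move=> [a1 [a2 H1]] [b1 [b2 H2]] [m1 [m2 Hg]].
exists (m1 * a1 + m2 * b1), (m1 * a2 + m2 * b2) => e e0.
pose A := normc a1 + normc a2 + normc b1 + normc b2 + 1.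
pose B := normc m1 + normc m2 + 1.
have A1 : 1 <= A by rewrite /A; have := normc_ge0 a1; have := normc_ge0 a2;
  have := normc_ge0 b1; have := normc_ge0 b2; lra.
have B1 : 1 <= B by rewrite /B; have := normc_ge0 m1; have := normc_ge0 m2; lra.
have e10 : 0 < e / (4 * A) by rewrite divr_gt0// mulr_gt0//; lra.
have [dg dg0 {}Hg] := Hg _ e10.
(* The cap 1 keeps the inner increments below [A * X]; the other term gives the inner remainders
   their share e/2. *)
pose e2 := Num.min 1 (e / (2 * B)).
have e20 : 0 < e2 by rewrite /e2 lt_min ltr01 divr_gt0// mulr_gt0//; lra.
have e21 : e2 <= 1 by rewrite /e2 ge_min lexx.
have e2B : e2 * B <= e / 2.
  rewrite -ler_pdivlMr; last by lra.
  rewrite /e2 ge_min; apply/orP; right; apply: eqR_le; field; lra.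
have [d1 d10 {}H1] := H1 _ e20; have [d2 d20 {}H2] := H2 _ e20.
have dA0 : 0 < dg / (2 * A) by rewrite divr_gt0// mulr_gt0//; lra.
exists (Num.min (Num.min d1 d2) (dg / (2 * A))); first by rewrite !lt_min d10 d20 dA0.
move=> s t; rewrite !lt_min => /andP[/andP[s1 s2] s3] /andP[/andP[t1 t2] t3].
have {}H1 := H1 s t s1 t1; have {}H2 := H2 s t s2 t2.
set X := normc s + normc t in H1 H2 *.
have ns := normc_ge0 s; have nt := normc_ge0 t.
have X0 : 0 <= X by rewrite /X; lra.
set k1 := h1 (z.1 + s, z.2 + t) - h1 z in H1.
set k2 := h2 (z.1 + s, z.2 + t) - h2 z in H2.
have lin (u v : R[i]) : normc u + normc v + 1 <= A -> normc (u * s + v * t) + e2 * X <= A * X.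
  move=> uv; apply: (@le_trans _ _ ((normc u + normc v + 1) * X)); last by rewrite ler_wpM2r.
  have : normc (u * s + v * t) <= normc u * normc s + normc v * normc t.
    by apply: le_trans (normcD_le _ _) _; rewrite !normcM.
  have : 0 <= normc u * normc t by rewrite mulr_ge0 ?normc_ge0.
  have : 0 <= normc v * normc s by rewrite mulr_ge0 ?normc_ge0.
  have : e2 * X <= 1 * X by rewrite ler_wpM2r.
  have -> : (normc u + normc v + 1) * X =
    normc u * normc s + normc u * normc t + (normc v * normc s + normc v * normc t) + 1 * X.
    by rewrite /X; ring.
  lra.
have K1 : normc k1 <= A * X.
  have -> : k1 = (k1 - (a1 * s + a2 * t)) + (a1 * s + a2 * t) by ring.
  apply: le_trans (normcD_le _ _) _; rewrite addrC; apply: le_trans (lin a1 a2 _).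
    by rewrite lerD2l.
  by rewrite /A; have := normc_ge0 b1; have := normc_ge0 b2; lra.
have K2 : normc k2 <= A * X.
  have -> : k2 = (k2 - (b1 * s + b2 * t)) + (b1 * s + b2 * t) by ring.
  apply: le_trans (normcD_le _ _) _; rewrite addrC; apply: le_trans (lin b1 b2 _).
    by rewrite lerD2l.
  by rewrite /A; have := normc_ge0 a1; have := normc_ge0 a2; lra.
have AX : A * X < dg.
  have : X < dg / A.
    have : dg / A = dg / (2 * A) + dg / (2 * A) by field; lra.
    by rewrite /X; lra.
  by rewrite ltr_pdivlMr; [rewrite mulrC|lra].
have := Hg k1 k2 (le_lt_trans K1 AX) (le_lt_trans K2 AX); rewrite /= /k1 /k2.
rewrite ![h1 z + _]addrC ![h2 z + _]addrC !subrK -/k1 -/k2 => {}Hg.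
set G := g _ - g _ in Hg *.
have -> : G - ((m1 * a1 + m2 * b1) * s + (m1 * a2 + m2 * b2) * t) =
  (G - (m1 * k1 + m2 * k2)) + (m1 * (k1 - (a1 * s + a2 * t)) + m2 * (k2 - (b1 * s + b2 * t))).
  by ring.
apply: le_trans (normcD_le _ _) _.
have -> : e * X = e / 2 * X + e / 2 * X by field.
apply: lerD.
  apply: le_trans Hg _.
  apply: (@le_trans _ _ (e / (4 * A) * (A * X + A * X))).
    by apply: ler_wpM2l; [exact: ltW|exact: lerD].
  by apply: eqR_le; field; lra.
apply: le_trans (normcD_le _ _) _; rewrite !normcM.
have h1' : normc m1 * normc (k1 - (a1 * s + a2 * t)) <= normc m1 * (e2 * X).
  by apply: ler_wpM2l => //; exact: normc_ge0.
have h2' : normc m2 * normc (k2 - (b1 * s + b2 * t)) <= normc m2 * (e2 * X).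
  by apply: ler_wpM2l => //; exact: normc_ge0.
apply: le_trans (lerD h1' h2') _.
apply: (@le_trans _ _ (e2 * B * X)); last by rewrite ler_wpM2r.
have : 0 <= e2 * X by rewrite mulr_ge0// ltW.
have -> : e2 * B * X = normc m1 * (e2 * X) + normc m2 * (e2 * X) + e2 * X.
  by rewrite /B; ring.
lra.
Qed.

Lemma hol_atZ c g z : hol_at g z -> hol_at (fun z => c * g z) z.
Proof.
move=> hg; apply: (@hol_at_comp (fun u => c * u.1) g g) => //.
exists c, 0 => e e0; exists 1 => // h1 h2 _ _ /=.
have -> : c * (g z + h1) - c * g z - (c * h1 + 0 * h2) = 0 by ring.
by rewrite normc0 mulr_ge0 ?addr_ge0 ?normc_ge0// ltW.
Qed.

Definition in_strip (r : R) z := `|complex.Im z.1| < r /\ `|complex.Im z.2| < r.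

Definition lip_on (r L : R) g := forall z w, in_strip r z -> in_strip r w ->
  normc (g z - g w) <= L * (normc (z.1 - w.1) + normc (z.2 - w.2)).

(** Giving up half of the strip leaves room for squares of half-side r/4 around each point, on which
    Cauchy's estimate has the constant 8 M / (r/4) = 32 M / r. It applies when both coordinates
    differ by at most r/8; otherwise |u - v| >= r/8 and the trivial bound 2 M is enough. *)
Lemma strip_lipschitz1 (k : R[i] -> R[i]) (r M : R) : 0 < r ->
  (forall u, `|complex.Im u| < r -> cdiff k u /\ normc (k u) <= M) ->
  forall u v, `|complex.Im u| < r / 2 -> `|complex.Im v| < r / 2 ->
    normc (k u - k v) <= 32 * M / r * normc (u - v).
Proof.
move=> r0 H [x1 y1] [x0 y0] /= iu iv.
have M0 : 0 <= M.
  by have [|_] := H (Complex x0 y0); [rewrite /=; lra|apply: le_trans; exact: normc_ge0].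
have [hx|hx] := leP `|x1 - x0| (r / 4 / 2); last first.
  have : r / 8 <= normc (Complex x1 y1 - Complex x0 y0).
    by apply: le_trans (normr_Re_le _) => /=; lra.
  move=> big; apply: le_trans (normcB_le _ _) _.
  have [|_ n1] := H (Complex x1 y1); first by rewrite /=; lra.
  have [|_ n0] := H (Complex x0 y0); first by rewrite /=; lra.
  apply: (@le_trans _ _ (32 * M / r * (r / 8))).
    have -> : 32 * M / r * (r / 8) = 4 * M by field; lra.
    lra.
  by apply: ler_wpM2l => //; rewrite divr_ge0 ?mulr_ge0// ltW.
have [hy|hy] := leP `|y1 - y0| (r / 4 / 2); last first.
  have : r / 8 <= normc (Complex x1 y1 - Complex x0 y0).
    by apply: le_trans (normr_Im_le _) => /=; lra.
  move=> big; apply: le_trans (normcB_le _ _) _.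
  have [|_ n1] := H (Complex x1 y1); first by rewrite /=; lra.
  have [|_ n0] := H (Complex x0 y0); first by rewrite /=; lra.
  apply: (@le_trans _ _ (32 * M / r * (r / 8))).
    have -> : 32 * M / r * (r / 8) = 4 * M by field; lra.
    lra.
  by apply: ler_wpM2l => //; rewrite divr_ge0 ?mulr_ge0// ltW.
have r40 : 0 < r / 4 by rewrite divr_gt0.
apply: le_trans (cauchy_lipschitz (M := M) r40 hx hy _) _.
  move=> x y _ yy; apply: H => /=.
  have -> : y = (y - y0) + y0 by ring.
  by apply: le_lt_trans (ler_normD _ _) _; lra.
by apply: eqR_le; congr (_ * _); field; lra.
Qed.

Lemma strip_lipschitz g (r M : R) : 0 < r ->
  (forall z, in_strip r z -> hol_at g z /\ normc (g z) <= M) ->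
  lip_on (r / 2) (32 * M / r) g.
Proof.
move=> r0 H z w [z1 z2] [w1 w2].
have -> : g z - g w = (g (z.1, z.2) - g (w.1, z.2)) + (g (w.1, z.2) - g (w.1, w.2)).
  by rewrite -!surjective_pairing; ring.
apply: le_trans (normcD_le _ _) _; rewrite mulrDr; apply: lerD.
  apply: (@strip_lipschitz1 (fun u => g (u, z.2)) r M) => // u ur.
  have [|[l1 [l2 hg]] bg] := H (u, z.2); first by split => //=; lra.
  split => //; exists l1 => e /hg[dl dl0 Hd]; exists dl => // h hd.
  have := Hd h 0 hd; rewrite normc0 => /(_ dl0) /=.
  by rewrite mulr0 !addr0.
apply: (@strip_lipschitz1 (fun u => g (w.1, u)) r M) => // u ur.
have [|[l1 [l2 hg]] bg] := H (w.1, u); first by split => //=; lra.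
split => //; exists l2 => e /hg[dl dl0 Hd]; exists dl => // h hd.
have := Hd 0 h; rewrite normc0 => /(_ dl0 hd) /=.
by rewrite mulr0 !addr0 !add0r.
Qed.

End HolomorphicTwo.

(** * Translations conjugated by analytic lifts *)

Import Normc.
Local Arguments normc : simpl never.

Lemma holomorphic_onE (U : set (CC * CC)) g :
  holomorphic_on U g <-> forall z, U z -> hol_at g z.
Proof.
have E (e : RR) (h1 h2 : CC) : (e%:C)%C * (`|h1| + `|h2|) = ((e * (normc h1 + normc h2))%:C)%C.
  by rewrite rmorphM rmorphD.
split=> H z /H[l1 [l2 Hl]]; exists l1, l2 => e /Hl.
- move=> [dl [dl0 Hd]]; exists dl => // h1 h2; rewrite -!ltc_real => a b.
  by have := Hd h1 h2 a b; rewrite E lec_real opprD addrA.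
- move=> [dl dl0 Hd]; exists dl; split => // h1 h2; rewrite !ltc_real => a b.
  by have := Hd h1 h2 a b; rewrite E lec_real opprD addrA.
Qed.

(** A quantitative form of [hol_ext]: the radius and both constants are exposed so that the four
    periodic parts of a map and of its inverse can share them. *)
Definition ana_ext (f : RR -> RR -> RR) (r L M : RR) (g : CC * CC -> CC) :=
  [/\ forall z, strip r z -> hol_at g z, forall z, strip r z -> normc (g z) <= M,
      lip_on r L g & forall x y : RR, g ((x%:C)%C, (y%:C)%C) = ((f x y)%:C)%C].

Lemma strip_real (r x y : RR) : 0 < r -> strip r ((x%:C)%C, (y%:C)%C).
Proof. by move=> r0; split; rewrite /= normr0. Qed.

Lemma ana_extP f : real_analytic_periodic f ->
  exists r L M g, [/\ 0 < r, 0 <= L, 0 <= M & ana_ext f r L M g].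
Proof.
move=> [_ [r [r0 [g [hg [[M Mg] fg]]]]]].
have {}Mg z : strip r z -> normc (g z) <= M by move=> /Mg; rewrite lec_real.
have {}hg z : strip r z -> hol_at g z by move: z; apply/holomorphic_onE.
have M0 : 0 <= M by apply: le_trans (Mg _ (strip_real 0 0 r0)); exact: normc_ge0.
have sub z : strip (r / 2) z -> strip r z by move=> [h1 h2]; split; lra.
exists (r / 2), (32 * M / r), M, g; split => //; first by rewrite divr_gt0.
  by rewrite divr_ge0 ?mulr_ge0// ltW.
split => // [z /sub|z /sub|]; [exact: hg|exact: Mg|].
by apply: strip_lipschitz => // z zr; split; [exact: hg|exact: Mg].
Qed.

Lemma ana_ext_weaken f (r L M r' L' M' : RR) g : r' <= r -> L <= L' -> M <= M' ->
  ana_ext f r L M g -> ana_ext f r' L' M' g.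
Proof.
move=> rr LL MM [h1 h2 h3 h4].
have sub z : strip r' z -> strip r z by move=> [? ?]; split; lra.
split => // [z /sub/h1//|z /sub/h2|z w /sub zr /sub wr].
  by move=> /le_trans; apply.
apply: le_trans (h3 z w zr wr) _; apply: ler_wpM2r => //.
by rewrite addr_ge0 ?normc_ge0.
Qed.

Lemma ana_ext_bounded f (r L M : RR) g x y : 0 < r -> ana_ext f r L M g -> `|f x y| <= M.
Proof.
move=> r0 [_ h _ fg]; have := h _ (strip_real x y r0).
by rewrite fg normc_real.
Qed.

Lemma ana_ext_lipschitz f (r L M : RR) g x y x' y' : 0 < r -> ana_ext f r L M g ->
  `|f x y - f x' y'| <= L * (`|x - x'| + `|y - y'|).
Proof.
move=> r0 [_ _ h fg]; have := h _ _ (strip_real x y r0) (strip_real x' y' r0).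
by rewrite /= !fg -!rmorphB !normc_real.
Qed.

Lemma periodic2_int f (m n : int) x y : periodic2 f ->
  f (x + m%:~R) (y + n%:~R) = f x y.
Proof.
move=> pf.
have pn (k : nat) u v : f (u + k%:R) v = f u v.
  elim: k => [|k IH] in u *; first by rewrite addr0.
  by rewrite mulrSr addrA (pf _ _).1.
have pn' (k : nat) u v : f u (v + k%:R) = f u v.
  elim: k => [|k IH] in v *; first by rewrite addr0.
  by rewrite mulrSr addrA (pf _ _).2.
have pm (k : int) u v : f (u + k%:~R) v = f u v.
  case: k => k; first exact: pn.
  by rewrite NegzE rmorphN /= -(pn k.+1 (u - _)) subrK.
have pm' (k : int) u v : f u (v + k%:~R) = f u v.
  case: k => k; first exact: pn'.
  by rewrite NegzE rmorphN /= -(pn' k.+1 _ (v - _)) subrK.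
by rewrite pm pm'.
Qed.

Definition trans (w p : RR * RR) : RR * RR := (p.1 + w.1, p.2 + w.2).

Definition conj_trans (S T : Map) (w : RR * RR) : Map := fun p => S (trans w (T p)).

Lemma bounded_linear_eq0 (k K : RR) : (forall x, `|k * x| <= K) -> k = 0.
Proof.
move=> H; apply/eqP; apply/negPn/negP => k0.
have := H ((K + 1) / k).
have -> : k * ((K + 1) / k) = K + 1 by field.
have := le_trans (normr_ge0 _) (H 0) => K0; rewrite ger0_norm; lra.
Qed.

(** * A common strip for all the maps S R_w T *)

Section ConjugatedTranslations.
Variables (T S : Map) (a b c d a' b' c' d' : int).
Variables (t1 t2 s1 s2 : RR -> RR -> RR) (r L M : RR) (gt1 gt2 gs1 gs2 : CC * CC -> CC).
Hypothesis TE : forall x y,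
  T (x, y) = (a%:~R * x + b%:~R * y + t1 x y, c%:~R * x + d%:~R * y + t2 x y).
Hypothesis SE : forall x y,
  S (x, y) = (a'%:~R * x + b'%:~R * y + s1 x y, c'%:~R * x + d'%:~R * y + s2 x y).
Hypotheses (pt1 : periodic2 t1) (pt2 : periodic2 t2) (ps1 : periodic2 s1) (ps2 : periodic2 s2).
Hypotheses (r0 : 0 < r) (L0 : 0 <= L) (M0 : 0 <= M).
Hypotheses (et1 : ana_ext t1 r L M gt1) (et2 : ana_ext t2 r L M gt2).
Hypotheses (es1 : ana_ext s1 r L M gs1) (es2 : ana_ext s2 r L M gs2).
Hypotheses (SK : forall p, S (T p) = p) (TK : forall p, T (S p) = p).

Local Notation A := (a%:~R : RR).
Local Notation B := (b%:~R : RR).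
Local Notation C := (c%:~R : RR).
Local Notation D := (d%:~R : RR).
Local Notation A' := (a'%:~R : RR).
Local Notation B' := (b'%:~R : RR).
Local Notation C' := (c'%:~R : RR).
Local Notation D' := (d'%:~R : RR).

(** The periodic parts are bounded, so two expressions that agree on the whole plane have the same
    linear coefficients. Applied to the rows of S, this shows that the linear parts of S and T are
    inverse to each other. *)
Lemma row_coeff (p q P Q : RR) (s : RR -> RR -> RR) (gs : CC * CC -> CC) :
  ana_ext s r L M gs ->
  (forall x y, p * (T (x, y)).1 + q * (T (x, y)).2 + s (T (x, y)).1 (T (x, y)).2 = P * x + Q * y) ->
  p * A + q * C = P /\ p * B + q * D = Q.
Proof.
move=> es H; pose K := `|p| * M + `|q| * M + M.
have bnd x y : `|p * t1 x y + q * t2 x y + s (T (x, y)).1 (T (x, y)).2| <= K.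
  apply: le_trans (ler_normD _ _) _; apply: lerD; last exact: ana_ext_bounded es.
  apply: le_trans (ler_normD _ _) _; rewrite !normrM; apply: lerD; apply: ler_wpM2l => //.
    exact: ana_ext_bounded et1.
  exact: ana_ext_bounded et2.
have {}H x y : p * t1 x y + q * t2 x y + s (T (x, y)).1 (T (x, y)).2 =
    - ((p * A + q * C - P) * x + (p * B + q * D - Q) * y).
  by have := H x y; rewrite TE /= => h; lra.
split; apply/eqP; rewrite -subr_eq0; apply/eqP; apply: (@bounded_linear_eq0 _ K) => x.
- by have := bnd x 0; rewrite H mulr0 addr0 normrN.
- by have := bnd 0 x; rewrite H mulr0 add0r normrN.
Qed.

Lemma inverse_coeffs : [/\ A' * A + B' * C = 1, A' * B + B' * D = 0,
  C' * A + D' * C = 0 & C' * B + D' * D = 1].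
Proof.
have [|h1 h2] := @row_coeff A' B' 1 0 s1 gs1 es1.
  move=> x y; have := SK (x, y); rewrite [T _]surjective_pairing SE => -[-> _]; ring.
have [|h3 h4] := @row_coeff C' D' 0 1 s2 gs2 es2.
  move=> x y; have := SK (x, y); rewrite [T _]surjective_pairing SE => -[_ ->]; ring.
by [].
Qed.

(** On the strip of width [rho] the imaginary parts of the extended T are at most [rho] times |A| +
    |B| + 2 L or |C| + |D| + 2 L. The [+ 1] makes the resulting bound by r strict and gives
    [rho <= r]. *)
Let rho := r / (`|A| + `|B| + `|C| + `|D| + 2 * L + 1).

Let den_ge1 : 1 <= `|A| + `|B| + `|C| + `|D| + 2 * L + 1.
Proof.
have := normr_ge0 A; have := normr_ge0 B; have := normr_ge0 C; have := normr_ge0 D.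
by move: L0; lra.
Qed.

Lemma rho_gt0 : 0 < rho.
Proof. by rewrite /rho divr_gt0//; apply: lt_le_trans den_ge1. Qed.

Lemma rho_le : rho <= r.
Proof. by rewrite /rho ler_pdivrMr ?(lt_le_trans _ den_ge1)// ler_peMr// ltW. Qed.

Let h1 (w : RR * RR) (z : CC * CC) := (A%:C)%C * z.1 + (B%:C)%C * z.2 + gt1 z + (w.1%:C)%C.
Let h2 (w : RR * RR) (z : CC * CC) := (C%:C)%C * z.1 + (D%:C)%C * z.2 + gt2 z + (w.2%:C)%C.

Lemma sub_rho z : strip rho z -> strip r z.
Proof. by have := rho_le => ? [? ?]; split; lra. Qed.

(** Since g is real on R^2, comparing g(z) with its value at the real parts of z bounds Im g(z) by L
    (|Im z1| + |Im z2|). The translation v is real and does not contribute, so the bound is uniform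
    in v. *)
Lemma Im_ext_lift (p q v : RR) t g z : ana_ext t r L M g -> strip rho z ->
  `|p| + `|q| + 2 * L < `|A| + `|B| + `|C| + `|D| + 2 * L + 1 ->
  `|complex.Im ((p%:C)%C * z.1 + (q%:C)%C * z.2 + g z + (v%:C)%C)| < r.
Proof.
move=> [_ _ lg tg] zr small; have zr' := sub_rho zr; case: zr => z1 z2.
have gim : `|complex.Im (g z)| <= L * (`|complex.Im z.1| + `|complex.Im z.2|).
  pose x := complex.Re z.1; pose y := complex.Re z.2.
  have := lg z ((x%:C)%C, (y%:C)%C) zr' (strip_real x y r0); rewrite tg.
  move=> /(le_trans (normr_Im_le _)); rewrite ImB /= subr0 => /le_trans; apply.
  rewrite /x /y; case: (z) => [[? i1] [? i2]] /=; simpc.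
  by rewrite /normc !(subrr, expr0n) /= !add0r !sqrtr_sqr.
have -> : complex.Im ((p%:C)%C * z.1 + (q%:C)%C * z.2 + g z + (v%:C)%C) =
   p * complex.Im z.1 + q * complex.Im z.2 + complex.Im (g z).
  by case: (g z) => ? ?; case: (z) => [[? ?] [? ?]] /=; ring.
have b1 : `|p * complex.Im z.1| <= `|p| * rho by rewrite normrM; apply: ler_wpM2l => //; exact: ltW.
have b2 : `|q * complex.Im z.2| <= `|q| * rho by rewrite normrM; apply: ler_wpM2l => //; exact: ltW.
have b3 : `|complex.Im (g z)| <= L * (rho + rho).
  by apply: le_trans gim _; apply: ler_wpM2l => //; lra.
apply: le_lt_trans (ler_normD _ _) _.
apply: le_lt_trans (lerD (ler_normD _ _) (lexx _)) _.
apply: le_lt_trans (lerD (lerD b1 b2) b3) _.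
have -> : `|p| * rho + `|q| * rho + L * (rho + rho) = rho * (`|p| + `|q| + 2 * L) by ring.
have -> : r = rho * (`|A| + `|B| + `|C| + `|D| + 2 * L + 1).
  by rewrite /rho divfK// gt_eqF// (lt_le_trans _ den_ge1).
by rewrite ltr_pM2l ?rho_gt0.
Qed.

Lemma lift_in_strip w z : strip rho z -> strip r (h1 w z, h2 w z).
Proof.
have := normr_ge0 A; have := normr_ge0 B; have := normr_ge0 C; have := normr_ge0 D.
move=> ? ? ? ? zr; split; rewrite /= /h1 /h2.
- by apply: Im_ext_lift et1 zr _; lra.
- by apply: Im_ext_lift et2 zr _; lra.
Qed.

(** The extension of one displacement of S R_w T, with (p, q) a row of the linear part of S. The
    terms linear in z have already been cancelled against the identity, so this function is bounded
    on the strip. *)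
Let ext (p q : RR) (gs : CC * CC -> CC) (w : RR * RR) (z : CC * CC) : CC :=
  (p%:C)%C * (gt1 z + (w.1%:C)%C) + (q%:C)%C * (gt2 z + (w.2%:C)%C) +
  gs (h1 w z, h2 w z).

Lemma hol_lift w z : strip rho z -> hol_at (h1 w) z /\ hol_at (h2 w) z.
Proof.
move=> /sub_rho zr; have [k1 _ _ _] := et1; have [k2 _ _ _] := et2.
split; (do 2 try apply: hol_atD); do ?[exact: hol_at_cst|exact: k1|exact: k2];
 by apply: hol_atD; apply: hol_atZ; [exact: hol_at_fst|exact: hol_at_snd].
Qed.

Lemma hol_ext_conj (p q : RR) s gs w (f : RR -> RR -> RR) : ana_ext s r L M gs ->
  (forall x y, f x y = p * (t1 x y + w.1) + q * (t2 x y + w.2) +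
     s ((T (x, y)).1 + w.1) ((T (x, y)).2 + w.2)) ->
  hol_ext rho f (ext p q gs w).
Proof.
move=> es fE; have [k1 m1 _ e1] := et1; have [k2 m2 _ e2] := et2; have [k3 m3 _ e3] := es.
split; [|split].
- apply/holomorphic_onE => z zr; have zr' := sub_rho zr; have [hh1 hh2] := hol_lift w zr.
  apply: hol_atD; first apply: hol_atD.
  + by apply: hol_atZ; apply: hol_atD; [exact: k1|exact: hol_at_cst].
  + by apply: hol_atZ; apply: hol_atD; [exact: k2|exact: hol_at_cst].
  + by apply: hol_at_comp => //; apply: k3; exact: lift_in_strip.
- exists (`|p| * (M + `|w.1|) + `|q| * (M + `|w.2|) + M) => z zr; rewrite lec_real.
  have zr' := sub_rho zr.
  apply: le_trans (normcD_le _ _) _; apply: lerD; last by apply: m3; exact: lift_in_strip.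
  apply: le_trans (normcD_le _ _) _; apply: lerD; rewrite normcM normc_real; apply: ler_wpM2l => //;
   apply: le_trans (normcD_le _ _) _; rewrite normc_real lerD2r; [exact: m1|exact: m2].
- move=> x y; rewrite /ext /h1 /h2 /= e1 e2 fE TE /=.
  by rewrite -!(rmorphD, rmorphM) e3 -!(rmorphD, rmorphM).
Qed.

(** Changing w moves the argument of gs by a real vector independent of z, so the Lipschitz bound
    for gs on the strip r is uniform in z. *)
Lemma ext_dist (p q : RR) s gs w w' z : ana_ext s r L M gs -> strip rho z ->
  normc (ext p q gs w z - ext p q gs w' z) <=
  (`|p| + `|q| + L) * (`|w.1 - w'.1| + `|w.2 - w'.2|).
Proof.
move=> [_ _ lg _] zr.
have -> : ext p q gs w z - ext p q gs w' z = (p%:C)%C * ((w.1 - w'.1)%:C)%C +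
   (q%:C)%C * ((w.2 - w'.2)%:C)%C + (gs (h1 w z, h2 w z) - gs (h1 w' z, h2 w' z)).
  by rewrite /ext !rmorphB; ring.
have h3 := lg _ _ (lift_in_strip w zr) (lift_in_strip w' zr).
have hh1 : h1 w z - h1 w' z = ((w.1 - w'.1)%:C)%C by rewrite /h1 rmorphB; ring.
have hh2 : h2 w z - h2 w' z = ((w.2 - w'.2)%:C)%C by rewrite /h2 rmorphB; ring.
rewrite /= hh1 hh2 !normc_real in h3.
apply: le_trans (normcD_le _ _) _.
apply: le_trans (lerD (normcD_le _ _) h3) _; rewrite !normcM !normc_real.
set u := `|w.1 - _|; set v := `|w.2 - _|.
have : 0 <= `|p| * v by apply: mulr_ge0; exact: normr_ge0.
have : 0 <= `|q| * u by apply: mulr_ge0; exact: normr_ge0.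
have -> : (`|p| + `|q| + L) * (u + v) = `|p| * u + `|q| * v + L * (u + v) + (`|p| * v + `|q| * u) by ring.
lra.
Qed.

Lemma disp1_conj w x y : disp1 (conj_trans S T w) x y =
  A' * (t1 x y + w.1) + B' * (t2 x y + w.2) + s1 ((T (x, y)).1 + w.1) ((T (x, y)).2 + w.2).
Proof.
have [i1 i2 _ _] := inverse_coeffs.
rewrite /disp1 /conj_trans /trans SE /= TE /=; set s := s1 _ _.
have xE : x = (A' * A + B' * C) * x + (A' * B + B' * D) * y by rewrite i1 i2; ring.
by apply/eqP; rewrite subr_eq; apply/eqP; rewrite [X in _ = _ + X]xE; ring.
Qed.

Lemma disp2_conj w x y : disp2 (conj_trans S T w) x y =
  C' * (t1 x y + w.1) + D' * (t2 x y + w.2) + s2 ((T (x, y)).1 + w.1) ((T (x, y)).2 + w.2).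
Proof.
have [_ _ i1 i2] := inverse_coeffs.
rewrite /disp2 /conj_trans /trans SE /= TE /=; set s := s2 _ _.
have yE : y = (C' * A + D' * C) * x + (C' * B + D' * D) * y by rewrite i1 i2; ring.
by apply/eqP; rewrite subr_eq; apply/eqP; rewrite [X in _ = _ + X]yE; ring.
Qed.

Lemma periodic_conj (p q : RR) s w : periodic2 s -> periodic2 (fun x y =>
  p * (t1 x y + w.1) + q * (t2 x y + w.2) + s ((T (x, y)).1 + w.1) ((T (x, y)).2 + w.2)).
Proof.
move=> ps x y; split.
- rewrite (pt1 _ _).1 (pt2 _ _).1; congr (_ + _).
  rewrite -[RHS](periodic2_int a c _ _ ps) !TE /= (pt1 _ _).1 (pt2 _ _).1.
  by congr s; ring.
- rewrite (pt1 _ _).2 (pt2 _ _).2; congr (_ + _).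
  rewrite -[RHS](periodic2_int b d _ _ ps) !TE /= (pt1 _ _).2 (pt2 _ _).2.
  by congr s; ring.
Qed.

Lemma conj_trans_inv w p :
  conj_trans S T (- w.1, - w.2) (conj_trans S T w p) = p.
Proof.
rewrite /conj_trans TK -{2}(SK p); congr S.
by case: (T p) => u v; rewrite /trans /= !addrK.
Qed.

Lemma id_type_conj w : id_type_lift (conj_trans S T w).
Proof.
split; split.
- have := periodic_conj A' B' w ps1; rewrite /periodic2 => H x y.
  by rewrite !disp1_conj; exact: H.
- exists rho; split; first exact: rho_gt0.
  exists (ext A' B' gs1 w); apply: (hol_ext_conj (s := s1)) => // x y.
  exact: disp1_conj.
- have := periodic_conj C' D' w ps2; rewrite /periodic2 => H x y.
  by rewrite !disp2_conj; exact: H.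
- exists rho; split; first exact: rho_gt0.
  exists (ext C' D' gs2 w); apply: (hol_ext_conj (s := s2)) => // x y.
  exact: disp2_conj.
Qed.

Lemma conj_trans_Diff_r w : in_Diff_r rho (conj_trans S T w).
Proof.
split; [split; first exact: id_type_conj|split].
- exists (conj_trans S T (- w.1, - w.2)); split; first exact: id_type_conj.
  split; first exact: conj_trans_inv.
  move=> p; have := conj_trans_inv (- w.1, - w.2) p; rewrite /= !opprK.
  by rewrite -surjective_pairing.
- by exists (ext A' B' gs1 w); apply: (hol_ext_conj (s := s1)) => // x y; exact: disp1_conj.
- by exists (ext C' D' gs2 w); apply: (hol_ext_conj (s := s2)) => // x y; exact: disp2_conj.
Qed.

Lemma conj_trans_dist w w' (eps : RR) :
  (`|A'| + `|B'| + `|C'| + `|D'| + L) * (`|w.1 - w'.1| + `|w.2 - w'.2|) < eps ->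
  dist_lt rho (conj_trans S T w) (conj_trans S T w') eps.
Proof.
move=> he; exists (ext A' B' gs1 w), (ext C' D' gs2 w), (ext A' B' gs1 w'), (ext C' D' gs2 w').
split; first by apply: (hol_ext_conj (s := s1)) => // x y; exact: disp1_conj.
split; first by apply: (hol_ext_conj (s := s2)) => // x y; exact: disp2_conj.
split; first by apply: (hol_ext_conj (s := s1)) => // x y; exact: disp1_conj.
split; first by apply: (hol_ext_conj (s := s2)) => // x y; exact: disp2_conj.
eexists; split; first exact: he.
have n1 := normr_ge0 A'; have n2 := normr_ge0 B'; have n3 := normr_ge0 C'; have n4 := normr_ge0 D'.
move=> z zr; rewrite !lec_real; split.
- apply: le_trans (ext_dist _ _ _ _ es1 zr) _; apply: ler_wpM2r; first exact: addr_ge0.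
  by lra.
- apply: le_trans (ext_dist _ _ _ _ es2 zr) _; apply: ler_wpM2r; first exact: addr_ge0.
  by lra.
Qed.

End ConjugatedTranslations.

Lemma analytic_lift_data (T : Map) : analytic_lift T ->
  exists (a b c d : int) (t1 t2 : RR -> RR -> RR), [/\
    forall x y, T (x, y) = (a%:~R * x + b%:~R * y + t1 x y, c%:~R * x + d%:~R * y + t2 x y),
    real_analytic_periodic t1 & real_analytic_periodic t2].
Proof.
move=> [a [b [c [d [h1 h2]]]]]; exists a, b, c, d; eexists; eexists; split; [|exact: h1|exact: h2].
by move=> x y; rewrite [LHS]surjective_pairing; congr (_, _); ring.
Qed.

(** The only analytic input of the density arguments: [rho] and [K] do not depend on w, so
    approximating w in R^2 approximates the map inside a single [in_Diff_r]. *)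
Lemma conj_trans_family (T S : Map) : analytic_lift T -> analytic_lift S ->
  (forall p, S (T p) = p) -> (forall p, T (S p) = p) ->
  exists rho K : RR, [/\ 0 < rho, 0 <= K,
    forall w, in_Diff_r rho (conj_trans S T w) &
    forall w w' eps, K * (`|w.1 - w'.1| + `|w.2 - w'.2|) < eps ->
      dist_lt rho (conj_trans S T w) (conj_trans S T w') eps].
Proof.
move=> /analytic_lift_data[a [b [c [d [t1 [t2 [TE pt1 pt2]]]]]]].
move=> /analytic_lift_data[a' [b' [c' [d' [s1 [s2 [SE ps1 ps2]]]]]]] SK TK.
have [r1 [L1 [M1 [g1 [r10 L10 M10 e1]]]]] := ana_extP pt1.
have [r2 [L2 [M2 [g2 [r20 L20 M20 e2]]]]] := ana_extP pt2.
have [r3 [L3 [M3 [g3 [r30 L30 M30 e3]]]]] := ana_extP ps1.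
have [r4 [L4 [M4 [g4 [r40 L40 M40 e4]]]]] := ana_extP ps2.
pose r := Num.min (Num.min r1 r2) (Num.min r3 r4).
pose L := L1 + L2 + L3 + L4; pose M := M1 + M2 + M3 + M4.
have r0 : 0 < r by rewrite /r !lt_min r10 r20 r30 r40.
have : r <= r by []; rewrite {2}/r !le_min => /andP[/andP[k1 k2] /andP[k3 k4]].
have L0 : 0 <= L by rewrite /L; lra.
have M0 : 0 <= M by rewrite /M; lra.
have {}e1 := ana_ext_weaken k1 (_ : L1 <= L) (_ : M1 <= M) e1.
have {}e2 := ana_ext_weaken k2 (_ : L2 <= L) (_ : M2 <= M) e2.
have {}e3 := ana_ext_weaken k3 (_ : L3 <= L) (_ : M3 <= M) e3.
have {}e4 := ana_ext_weaken k4 (_ : L4 <= L) (_ : M4 <= M) e4.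
have {}e1 := e1 ltac:(by rewrite /L; lra) ltac:(by rewrite /M; lra).
have {}e2 := e2 ltac:(by rewrite /L; lra) ltac:(by rewrite /M; lra).
have {}e3 := e3 ltac:(by rewrite /L; lra) ltac:(by rewrite /M; lra).
have {}e4 := e4 ltac:(by rewrite /L; lra) ltac:(by rewrite /M; lra).
have [qt1 _] := pt1; have [qt2 _] := pt2; have [qs1 _] := ps1; have [qs2 _] := ps2.
eexists; eexists; split; last 2 first.
- move=> w; apply: (conj_trans_Diff_r TE SE qt1 qt2 qs1 qs2 r0 L0 e1 e2 e3 e4 SK TK).
- move=> w w' eps; exact: (conj_trans_dist TE SE r0 L0 e1 e2 e3 e4 SK).
- exact: (rho_gt0 _ _ _ _ r0 L0).
- by rewrite !addr_ge0.
Qed.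

(** * Lifts as Lipschitz equivariant maps; the form of the elements of A_alpha *)

Definition lipschitz2 (T : Map) := exists2 K : RR, 0 <= K & forall p q,
  `|(T p).1 - (T q).1| <= K * (`|p.1 - q.1| + `|p.2 - q.2|) /\
  `|(T p).2 - (T q).2| <= K * (`|p.1 - q.1| + `|p.2 - q.2|).

Lemma analytic_lift_lipschitz (T : Map) : analytic_lift T -> lipschitz2 T.
Proof.
move=> /analytic_lift_data[a [b [c [d [t1 [t2 [TE pt1 pt2]]]]]]].
have [r1 [L1 [M1 [g1 [r10 L10 M10 e1]]]]] := ana_extP pt1.
have [r2 [L2 [M2 [g2 [r20 L20 M20 e2]]]]] := ana_extP pt2.
have aff (u v L K : RR) t (p q : RR * RR) : 0 <= L -> `|u| + `|v| + L <= K ->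
  `|t p.1 p.2 - t q.1 q.2| <= L * (`|p.1 - q.1| + `|p.2 - q.2|) ->
  `|(u * p.1 + v * p.2 + t p.1 p.2) - (u * q.1 + v * q.2 + t q.1 q.2)| <=
    K * (`|p.1 - q.1| + `|p.2 - q.2|).
  move=> L0 uvK tt.
  have -> : (u * p.1 + v * p.2 + t p.1 p.2) - (u * q.1 + v * q.2 + t q.1 q.2) =
    (u * (p.1 - q.1) + v * (p.2 - q.2)) + (t p.1 p.2 - t q.1 q.2) by ring.
  apply: le_trans (ler_normD _ _) _.
  apply: le_trans (lerD (ler_normD _ _) tt) _; rewrite !normrM.
  set m := `|p.1 - _|; set n := `|p.2 - _|.
  have m0 : 0 <= m by exact: normr_ge0.
  have n0 : 0 <= n by exact: normr_ge0.
  have un : 0 <= `|u| * n by rewrite mulr_ge0.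
  have vm : 0 <= `|v| * m by rewrite mulr_ge0.
  apply: (@le_trans _ _ ((`|u| + `|v| + L) * (m + n))).
    have -> : (`|u| + `|v| + L) * (m + n) = `|u| * m + `|v| * n + L * (m + n) + (`|u| * n + `|v| * m) by ring.
    lra.
  by apply: ler_wpM2r => //; lra.
pose K : RR := `|a%:~R| + `|b%:~R| + `|c%:~R| + `|d%:~R| + L1 + L2.
have na := normr_ge0 (a%:~R : RR); have nb := normr_ge0 (b%:~R : RR).
have nc := normr_ge0 (c%:~R : RR); have nd := normr_ge0 (d%:~R : RR).
exists K; first by rewrite /K; lra.
move=> p q; rewrite (surjective_pairing p) (surjective_pairing q) !TE /=; split.
- apply: (aff _ _ L1) => //; first by rewrite /K; lra.
  exact: ana_ext_lipschitz e1.
- apply: (aff _ _ L2) => //; first by rewrite /K; lra.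
  exact: ana_ext_lipschitz e2.
Qed.

Definition int_equivariant (T : Map) := forall p (m n : int), exists k l : int,
  T (p.1 + m%:~R, p.2 + n%:~R) = ((T p).1 + k%:~R, (T p).2 + l%:~R).

Lemma analytic_lift_equivariant (T : Map) : analytic_lift T -> int_equivariant T.
Proof.
move=> /analytic_lift_data[a [b [c [d [t1 [t2 [TE [pt1 _] [pt2 _]]]]]]]] p m n.
exists (a * m + b * n), (c * m + d * n).
rewrite [in RHS](surjective_pairing p) !TE /= (periodic2_int m n _ _ pt1) (periodic2_int m n _ _ pt2).
by congr (_, _); rewrite rmorphD !rmorphM /=; ring.
Qed.

Lemma id_type_analytic_lift (G : Map) : id_type_lift G -> analytic_lift G.
Proof.
move=> [h1 h2]; exists 1, 0, 0, 1; split.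
- suff -> : (fun x y => (G (x, y)).1 - (1%:~R * x + 0%:~R * y)) = disp1 G by [].
  by apply/funext => x; apply/funext => y; rewrite /disp1; ring.
- suff -> : (fun x y => (G (x, y)).2 - (0%:~R * x + 1%:~R * y)) = disp2 G by [].
  by apply/funext => x; apply/funext => y; rewrite /disp2; ring.
Qed.

(** The segment from the origin to p is cut into equal steps so short that u changes by less than 1
    on each; being an integer, it does not change at all. *)
Lemma lipschitz_int_const (u : RR * RR -> RR) (K : RR) : 0 <= K ->
  (forall p q, `|u p - u q| <= K * (`|p.1 - q.1| + `|p.2 - q.2|)) ->
  (forall p, exists k : int, u p = k%:~R) -> forall p, u p = u (0, 0).
Proof.
move=> K0 lu iu p.
pose N := K * (`|p.1| + `|p.2|).
have N0 : 0 <= N by rewrite mulr_ge0// addr_ge0.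
have [n nN] : exists n : nat, N < n.+1%:R.
  exists (Num.truncn N); exact: truncnS_gt.
have n0 : (0 : RR) < n.+1%:R by rewrite ltr0n.
pose q (i : nat) : RR * RR := (i%:R / n.+1%:R * p.1, i%:R / n.+1%:R * p.2).
have step i : u (q i.+1) = u (q i).
  have [k kE] := iu (q i.+1); have [l lE] := iu (q i).
  have : `|u (q i.+1) - u (q i)| < 1.
    apply: le_lt_trans (lu _ _) _.
    have -> : (q i.+1).1 - (q i).1 = p.1 / n.+1%:R by rewrite /q /= -natr1; field; rewrite gt_eqF.
    have -> : (q i.+1).2 - (q i).2 = p.2 / n.+1%:R by rewrite /q /= -natr1; field; rewrite gt_eqF.
    rewrite !normrM normfV (ger0_norm (ltW n0)) -mulrDl mulrA ltr_pdivrMr//.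
    by rewrite mul1r.
  rewrite kE lE -rmorphB -intr_norm -[1]/(1%:~R) ltr_int.
  by rewrite -[1]add0r ltzD1 normr_le0 subr_eq0 => /eqP ->.
have qn : q n.+1 = p by rewrite /q divff ?gt_eqF// !mul1r -surjective_pairing.
have q0 : q 0%N = (0, 0) by rewrite /q mul0r !mul0r.
rewrite -qn -q0; elim: {qn nN n0} n.+1 => [//|i IH].
by rewrite step.
Qed.

(** In [A_alpha] the integers k1 and k2 may depend on the point. They are Lipschitz functions of it,
    hence constant, and can be absorbed into the translation vector. *)
Lemma A_alpha_conj_trans (alpha : RR) (G : Map) : A_alpha alpha G ->
  exists (T S : Map) (w : RR * RR), [/\ analytic_lift T, analytic_lift S,
    area_preserving T, (forall p, S (T p) = p) /\ (forall p, T (S p) = p) &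
    G = conj_trans S T w].
Proof.
move=> [[iG _] [T [[aT [S [aS [SK TK]]]] [arT H]]]].
have [KT KT0 lT] := analytic_lift_lipschitz aT.
have [KG KG0 lG] := analytic_lift_lipschitz (id_type_analytic_lift iG).
have lTG p q (i := `|p.1 - q.1| + `|p.2 - q.2|) :
  `|(T (G p)).1 - (T (G q)).1| <= KT * (2 * KG) * i /\
  `|(T (G p)).2 - (T (G q)).2| <= KT * (2 * KG) * i.
  have [g1 g2] := lG p q; have [k1 k2] := lT (G p) (G q).
  have le : KT * (`|(G p).1 - (G q).1| + `|(G p).2 - (G q).2|) <= KT * (2 * KG) * i.
    by rewrite -mulrA; apply: ler_wpM2l => //; apply: le_trans (lerD g1 g2) _; rewrite /i; lra.
  by split; [exact: le_trans le|exact: le_trans le].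
pose K := KT * (2 * KG) + KT.
have K0 : 0 <= K by rewrite /K addr_ge0// mulr_ge0// mulr_ge0.
pose u1 p := (T (G p)).1 - (T p).1 - alpha.
pose u2 p := (T (G p)).2 - (T p).2.
have c1 : forall p, u1 p = u1 (0, 0).
  apply: (lipschitz_int_const K0) => [p q|p].
    have -> : u1 p - u1 q = ((T (G p)).1 - (T (G q)).1) - ((T p).1 - (T q).1).
      by rewrite /u1; ring.
    apply: le_trans (ler_normB _ _) _; rewrite mulrDl; apply: lerD.
      by have [] := lTG p q.
    by have [] := lT p q.
  by have [k [l E]] := H p; exists k; rewrite /u1 E /=; ring.
have c2 : forall p, u2 p = u2 (0, 0).
  apply: (lipschitz_int_const K0) => [p q|p].
    have -> : u2 p - u2 q = ((T (G p)).2 - (T (G q)).2) - ((T p).2 - (T q).2).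
      by rewrite /u2; ring.
    apply: le_trans (ler_normB _ _) _; rewrite mulrDl; apply: lerD.
      by have [] := lTG p q.
    by have [] := lT p q.
  by have [k [l E]] := H p; exists l; rewrite /u2 E /=; ring.
exists T, S, (u1 (0, 0) + alpha, u2 (0, 0)); split => //.
apply/funext => p; rewrite /conj_trans -(SK (G p)); congr S.
rewrite [LHS]surjective_pairing /trans /= -(c1 p) -(c2 p) /u1 /u2.
by congr (_, _); ring.
Qed.

(** * Composition with integer linear maps *)

Definition linmap (a b c d : int) : Map := fun p =>
  (a%:~R * p.1 + b%:~R * p.2, c%:~R * p.1 + d%:~R * p.2).

Lemma real_analytic_periodic_lincomb (m n : RR) f g :
  real_analytic_periodic f -> real_analytic_periodic g ->
  real_analytic_periodic (fun x y => m * f x y + n * g x y).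
Proof.
move=> [pf [r [r0 [F [hF [[M bF] eF]]]]]] [pg [s [s0 [G [hG [[N bG] eG]]]]]].
split; first by move=> x y; rewrite (pf _ _).1 (pf _ _).2 (pg _ _).1 (pg _ _).2.
exists (Num.min r s); split; first by rewrite lt_min r0.
have sub z : strip (Num.min r s) z -> strip r z /\ strip s z.
  by move=> []; rewrite !lt_min => /andP[? ?] /andP[? ?].
exists (fun z => (m%:C)%C * F z + (n%:C)%C * G z); split; [|split].
- apply/holomorphic_onE => z /sub[zr zs]; apply: hol_atD; apply: hol_atZ.
    by move/holomorphic_onE : hF; apply.
  by move/holomorphic_onE : hG; apply.
- exists (`|m| * M + `|n| * N) => z /sub[/bF + /bG]; rewrite !lec_real => ? ?.
  apply: le_trans (normcD_le _ _) _; rewrite !normcM !normc_real.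
  by apply: lerD; apply: ler_wpM2l.
- by move=> x y; rewrite eF eG rmorphD !rmorphM.
Qed.

Lemma real_analytic_periodic_linmap (a b c d : int) f : real_analytic_periodic f ->
  real_analytic_periodic (fun x y => f (a%:~R * x + b%:~R * y) (c%:~R * x + d%:~R * y)).
Proof.
move=> [pf [r [r0 [F [hF [[M bF] eF]]]]]]; split.
  move=> x y; split; rewrite -[RHS](periodic2_int a c _ _ pf).
    by congr f; ring.
  by rewrite (periodic2_int a c _ _ pf) -[RHS](periodic2_int b d _ _ pf); congr f; ring.
pose A : RR := a%:~R; pose B : RR := b%:~R; pose C : RR := c%:~R; pose D : RR := d%:~R.
pose K := `|A| + `|B| + `|C| + `|D| + 1.
have na := normr_ge0 A; have nb := normr_ge0 B; have nc := normr_ge0 C; have nd := normr_ge0 D.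
have K0 : 0 < K by rewrite /K; lra.
pose h1 (z : CC * CC) := (A%:C)%C * z.1 + (B%:C)%C * z.2.
pose h2 (z : CC * CC) := (C%:C)%C * z.1 + (D%:C)%C * z.2.
have rK0 : 0 < r / K by rewrite divr_gt0.
have key (p q : RR) (z : CC * CC) : strip (r / K) z -> `|p| + `|q| + 1 <= K ->
    `|complex.Im ((p%:C)%C * z.1 + (q%:C)%C * z.2)| < r.
  case: z => [[? x] [? y]] [/= hx hy] pqK; rewrite !(mul0r, addr0).
  apply: le_lt_trans (ler_normD _ _) _; rewrite !normrM.
  have k1 : `|p| * `|x| <= `|p| * (r / K) by apply: ler_wpM2l => //; exact: ltW.
  have k2 : `|q| * `|y| <= `|q| * (r / K) by apply: ler_wpM2l => //; exact: ltW.
  apply: le_lt_trans (lerD k1 k2) _; rewrite -mulrDl mulrA ltr_pdivrMr// mulrC ltr_pM2l//.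
  by lra.
have str z : strip (r / K) z -> strip r (h1 z, h2 z).
  by move=> zr; split; apply: key => //; rewrite /K; lra.
exists (r / K); split => //; exists (fun z => F (h1 z, h2 z)); split; [|split].
- apply/holomorphic_onE => z zr; apply: hol_at_comp.
  + by apply: hol_atD; apply: hol_atZ; [exact: hol_at_fst|exact: hol_at_snd].
  + by apply: hol_atD; apply: hol_atZ; [exact: hol_at_fst|exact: hol_at_snd].
  + by move/holomorphic_onE : hF; apply; exact: str.
- by exists M => z /str/bF.
- by move=> x y; rewrite /h1 /h2 /= -!(rmorphM, rmorphD) eF.
Qed.

Lemma analytic_lift_linmap_comp (a b c d : int) (T : Map) : analytic_lift T ->
  analytic_lift (linmap a b c d \o T).
Proof.
move=> /analytic_lift_data[a' [b' [c' [d' [t1 [t2 [TE pt1 pt2]]]]]]].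
exists (a * a' + b * c'), (a * b' + b * d'), (c * a' + d * c'), (c * b' + d * d'); split.
- have := real_analytic_periodic_lincomb a%:~R b%:~R pt1 pt2.
  congr real_analytic_periodic; apply/funext => x; apply/funext => y.
  by rewrite /= TE /= !rmorphD !rmorphM /=; ring.
- have := real_analytic_periodic_lincomb c%:~R d%:~R pt1 pt2.
  congr real_analytic_periodic; apply/funext => x; apply/funext => y.
  by rewrite /= TE /= !rmorphD !rmorphM /=; ring.
Qed.

Lemma analytic_lift_comp_linmap (a b c d : int) (T : Map) : analytic_lift T ->
  analytic_lift (T \o linmap a b c d).
Proof.
move=> /analytic_lift_data[a' [b' [c' [d' [t1 [t2 [TE pt1 pt2]]]]]]].
exists (a' * a + b' * c), (a' * b + b' * d), (c' * a + d' * c), (c' * b + d' * d); split.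
- have := real_analytic_periodic_linmap a b c d pt1.
  congr real_analytic_periodic; apply/funext => x; apply/funext => y.
  by rewrite /= TE /= !rmorphD !rmorphM /=; ring.
- have := real_analytic_periodic_linmap a b c d pt2.
  congr real_analytic_periodic; apply/funext => x; apply/funext => y.
  by rewrite /= TE /= !rmorphD !rmorphM /=; ring.
Qed.

(** * Dense orbits of translations *)

Section DenseOrbits.
Variable R : realType.
Implicit Types (b t e : R).

(** Irrationality in the form that passes to nonzero integer multiples and that the pigeonhole
    argument uses. *)
Definition int_free b := forall m k : int, m%:~R * b = k%:~R -> m = 0.

Lemma irrational_int_free b : irrational b -> int_free b.
Proof.
move=> ib m k mk; apply/eqP/negPn/negP => m0; apply: ib.
exists (k%:~R / m%:~R) => //.
by rewrite fmorph_div /= !ratr_int -mk mulrC mulKf// intr_eq0.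
Qed.

Lemma int_freeZ b (m : int) : m != 0 -> int_free b -> int_free (m%:~R * b).
Proof.
move=> m0 ib p k; rewrite mulrA -intrM => /ib/eqP.
by rewrite mulf_eq0 (negbTE m0) orbF => /eqP.
Qed.

(** Pigeonhole: among n + 1 fractional parts of multiples of b, two fall into the same of n boxes of
    length 1/n < e. Their difference is nonzero because b is [int_free]. *)
Lemma dirichlet_small b e : int_free b -> 0 < e ->
  exists (m : nat) (k : int), (0 < m)%N /\ 0 < `|m%:R * b + k%:~R| < e.
Proof.
move=> ib e0.
pose n := (Num.truncn e^-1).+1.
have n0 : (0 : R) < n%:R by rewrite ltr0n.
have ne : n%:R^-1 < e by rewrite invf_plt ?posrE// truncnS_gt.
pose fr (i : nat) : R := i%:R * b - (Num.floor (i%:R * b))%:~R.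
have fr0 i : 0 <= fr i by rewrite subr_ge0 floor_le.
have fr1 i : fr i < 1.
  by have := floorD1_gt (i%:R * b); rewrite intrD /fr; lra.
have box i : (Num.truncn (n%:R * fr i) < n)%N.
  rewrite -(ltr_nat R); apply: (@le_lt_trans _ _ (n%:R * fr i)).
    by have /andP[] := truncn_itv (mulr_ge0 (ltW n0) (fr0 i)).
  by rewrite gtr_pMr.
pose f (i : 'I_n.+1) : 'I_n := Ordinal (box i).
have /injectivePn[i [j ij fij]] : ~~ injectiveb f.
  apply/negP => /injectiveP/leq_card; rewrite !card_ord ltnn//.
have close : `|fr i - fr j| < n%:R^-1.
  have /andP[i1 i2] := truncn_itv (mulr_ge0 (ltW n0) (fr0 i)).
  have /andP[j1 j2] := truncn_itv (mulr_ge0 (ltW n0) (fr0 j)).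
  have fE : Num.truncn (n%:R * fr i) = Num.truncn (n%:R * fr j) by case: fij.
  rewrite fE in i1 i2.
  rewrite -(ltr_pM2l n0) mulfV ?gt_eqF// -{1}(ger0_norm (ltW n0)) -normrM mulrBr.
  move: i2 j2; rewrite -natr1 ltr_norml => i2 j2; apply/andP; split; lra.
wlog ltij : i j ij fij close / (i < j)%N.
  move=> W; have [lt|gt|eq] := ltngtP i j; first exact: (W i j).
    by apply: (W j i) => //; [rewrite eq_sym|rewrite distrC].
  by move/negP : ij; case; apply/eqP/val_inj.
pose k : int := Num.floor (i%:R * b) - Num.floor (j%:R * b).
have E : (j - i)%N%:R * b + k%:~R = fr j - fr i.
  by rewrite /fr /k intrB natrB ?(ltnW ltij)//; ring.
exists (j - i)%N, k; rewrite subn_gt0 E; split => //.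
apply/andP; split; last by rewrite distrC (lt_trans close).
rewrite normr_gt0 -E; apply/negP => /eqP z.
have /eqP : ((j - i)%N : int) = 0.
  by apply: (ib _ (- k)); rewrite intrN; apply/eqP; rewrite -subr_eq0 opprK; exact/eqP.
by rewrite eqz_nat subn_eq0 leqNgt ltij.
Qed.

(** Steps of nonzero size less than e reach every point up to e. The lower bound N0 on N serves
    twice: to get a nonzero multiple, and to get arbitrarily large ones in the Baire argument. *)
Lemma orbit_dense b e t (N0 : nat) : int_free b -> 0 < e ->
  exists (N : nat) (k : int), (N0 <= N)%N /\ `|N%:R * b + k%:~R - t| < e.
Proof.
move=> ib e0; have [m [k [m0 /andP[d0 de]]]] := dirichlet_small ib e0.
set dl := m%:R * b + k%:~R in d0 de.
have dl0 : dl != 0 by rewrite -normr_gt0.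
pose s := t - N0%:R * b.
(* The number of steps is a natural number, so the target is first moved by an integer to the side
   towards which [dl] points. *)
have [l sl] : exists l : int, 0 <= (s + l%:~R) / dl.
  have [dp|dn] := ltP 0 dl.
    exists (- Num.floor s); rewrite intrN; apply: divr_ge0; last exact: ltW.
    by rewrite subr_ge0 floor_le.
  exists (- (Num.floor s + 1)); set x := s + _.
  have -> : x / dl = (- x) / (- dl) by rewrite invrN mulrNN.
  apply: divr_ge0; last by rewrite oppr_ge0.
  rewrite /x.
  by rewrite oppr_ge0 intrN subr_le0 ltW// floorD1_gt.
pose j := Num.truncn ((s + l%:~R) / dl).
have /andP[j1 j2] := truncn_itv sl.
exists (N0 + j * m)%N, ((j : int) * k - l); split; first by rewrite leq_addr.
have -> : (N0 + j * m)%N%:R * b + ((j : int) * k - l)%:~R - t = j%:R * dl - (s + l%:~R).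
  by rewrite /dl /s natrD natrM intrB intrM; ring.
have -> : s + l%:~R = (s + l%:~R) / dl * dl by rewrite divfK.
rewrite -mulrBl normrM; apply: le_lt_trans de; apply: ler_piMl => //.
by rewrite ler_norml; rewrite -natr1 in j2; rewrite /j; apply/andP; split; lra.
Qed.

Definition dense_orbit (v : R * R) := forall (u : R * R) e, 0 < e ->
  exists (N : nat) (k l : int), `|N%:R * v.1 - u.1 - k%:~R| < e /\ `|N%:R * v.2 - u.2 - l%:~R| < e.

Lemma irrational_near t e : 0 < e -> exists2 b, irrational b & `|b - t| < e.
Proof.
move=> e0; have [F oF FE] := @irrational_Gdelta R.
have := Baire oF; rewrite -FE => /(_ (ball t e)) [||b [+ ib]].
- by exists t; exact: ballxx.
- exact: ball_open.
by rewrite /ball /= distrC => tb; exists b.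
Qed.

(* The second coordinate is fixed to be irrational; for the first one, being
   carried close to a prescribed point by some multiple N is an open condition,
   dense because N can be taken arbitrarily large: Baire applies on the line. *)
Lemma dense_orbit_near (w : R * R) e : 0 < e ->
  exists v, dense_orbit v /\ `|v.1 - w.1| < e /\ `|v.2 - w.2| < e.
Proof.
move=> e0; have [b ib bw] := irrational_near w.2 e0.
have fb := irrational_int_free ib.
pose hit (q : rat * rat * nat) (x : R) := exists (N : nat) (k l : int),
   `|N%:R * x - ratr q.1.1 - k%:~R| < q.2.+1%:R^-1 /\ `|N%:R * b - ratr q.1.2 - l%:~R| < q.2.+1%:R^-1.
(* One condition per rational target and tolerance, enumerated by [unpickle]; an index that codes
   nothing imposes no condition. *)
pose F (i : nat) : set R := if unpickle i is Some q then [set x | hit q x] else setT.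
have oF i : open (F i) /\ dense (F i).
  rewrite /F; case: unpickle => [[[q1 q2] n]|]; last first.
    by split; [exact: openT|move=> O [x Ox] _; exists x].
  have n0 : (0 : R) < n.+1%:R^-1 by rewrite invr_gt0 ltr0n.
  split.
    have -> : [set x | hit (q1, q2, n) x] = \bigcup_(Nkl in [set Nkl : nat * int * int |
       `|Nkl.1.1%:R * b - ratr q2 - Nkl.2%:~R| < n.+1%:R^-1])
       ((fun x : R => Nkl.1.1%:R * x - ratr q1 - Nkl.1.2%:~R : R) @^-1` ball (0 : R) n.+1%:R^-1).
      apply/seteqP; split => x /=.
        move=> [N [k [l [h1 h2]]]]; exists (N, k, l) => //=.
        by rewrite /ball /= sub0r normrN.
      move=> [[[N k] l] /= h2]; rewrite /ball /= sub0r normrN => h1.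
      by exists N, k, l.
    apply: bigcup_open => -[[N k] l] _; apply: open_comp; last exact: ball_open.
    move=> x _; apply: cvgB; last exact: cvg_cst.
    apply: cvgB; last exact: cvg_cst.
    by apply: cvgM; [exact: cvg_cst|exact: cvg_id].
  move=> O [x Ox] oO.
  have /nbhs_ballP[d /= d0 dO] : nbhs x O by apply: open_nbhs_nbhs; split.
  (* Once N > 1/d, moving x by at most 1/N < d makes N y equal to the target modulo 1 exactly, while
     N b is already close to the other target. *)
  pose N0 := (Num.truncn d^-1).+1.
  have [N [l [NN hN]]] := orbit_dense (ratr q2) N0 fb n0.
  have N00 : (0 : R) < N%:R by rewrite ltr0n (leq_trans _ NN).
  have Nd : N%:R^-1 < d.
    by rewrite invf_plt ?posrE// (lt_le_trans (truncnS_gt _))// ler_nat.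
  pose k : int := Num.floor (N%:R * x - ratr q1).
  pose y : R := (ratr q1 + k%:~R) / N%:R.
  have Ny : N%:R * y = ratr q1 + k%:~R by rewrite /y mulrC divfK ?gt_eqF.
  exists y; split.
    apply: dO; rewrite /ball /=; apply: le_lt_trans Nd.
    rewrite -(ler_pM2l N00) mulfV ?gt_eqF// -{1}(ger0_norm (ltW N00)) -normrM mulrBr Ny.
    have := floor_itv (N%:R * x - ratr q1); rewrite -/k intrD => /andP[k1 k2].
    by rewrite ler_norml; apply/andP; split; lra.
  exists N, k, (- l); rewrite Ny /= intrN opprK; split.
    by rewrite [_ - ratr q1]addrAC subrr add0r subrr normr0.
  by apply: le_lt_trans hN; apply: eqR_le; congr `|_|; ring.
have [||x [xw Fx]] := Baire oF (O := ball w.1 e).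
- by exists w.1; exact: ballxx.
- exact: ball_open.
exists (x, b); split; last by split => //=; rewrite distrC.
move=> u d d0.
pose n := Num.truncn (2 / d).
have nd : n.+1%:R^-1 < d / 2.
  by rewrite invf_plt ?posrE ?divr_gt0// invf_div truncnS_gt.
have approx (c : R) : exists q : rat, `|ratr q - c| < d / 2.
  have [|q] := @rat_in_itvoo _ c (c + d / 2); first by lra.
  rewrite in_itv /= => /andP[q1 q2]; exists q; rewrite ltr_norml; apply/andP; split; lra.
have [q1 h1] := approx u.1; have [q2 h2] := approx u.2.
have := Fx (pickle (q1, q2, n)) Logic.I; rewrite /F pickleK => -[N [k [l [/= k1 k2]]]].
have {}k1 := lt_trans k1 nd; have {}k2 := lt_trans k2 nd.
exists N, k, l; move: h1 h2 k1 k2; rewrite !ltr_norml.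
move=> /andP[? ?] /andP[? ?] /andP[? ?] /andP[? ?]; split; apply/andP; split; lra.
Qed.

End DenseOrbits.

(** * Measures on the torus *)

Local Notation frac := Defs.frac.

Lemma frac_ge0 (x : RR) : 0 <= frac x.
Proof. by rewrite /frac subr_ge0 floor_le. Qed.

Lemma frac_lt1 (x : RR) : frac x < 1.
Proof. by have := floorD1_gt x; rewrite /frac intrD; lra. Qed.

Lemma frac_id (x : RR) : 0 <= x < 1 -> frac x = x.
Proof.
by move=> x01; rewrite /frac (floor_def (m := 0)) ?subr0// add0r.
Qed.

Lemma frac_addz (x : RR) (k : int) : frac (x + k%:~R) = frac x.
Proof.
rewrite /frac (floor_def (m := Num.floor x + k)); first by rewrite intrD; ring.
have /andP[h1 h2] := floor_itv x; rewrite !intrD in h2 *.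
by apply/andP; split; lra.
Qed.

Lemma frac_int (x : RR) : exists k : int, frac x = x + k%:~R.
Proof. by exists (- Num.floor x); rewrite intrN. Qed.

Lemma measurable_frac : measurable_fun setT (frac : measurableTypeR RR -> measurableTypeR RR).
Proof.
apply: measurable_funB; first exact: measurable_id.
apply: nondecreasing_measurable => // x y xy; rewrite ler_int.
exact: le_floor.
Qed.

Definition torus_proj : T2 -> T2 := fun p => (frac p.1, frac p.2).

Lemma torus_projK p : fund_dom p -> torus_proj p = p.
Proof. by move=> [h1 h2]; rewrite /torus_proj !frac_id// -surjective_pairing. Qed.

Lemma torus_proj_fund p : fund_dom (torus_proj p).
Proof. by split; rewrite /= frac_ge0 frac_lt1. Qed.

Lemma torus_map_fund (F : Map) p : fund_dom (torus_map F p).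
Proof. exact: torus_proj_fund. Qed.

Lemma torus_map_proj (F : Map) p : int_equivariant F ->
  torus_map F (torus_proj p) = torus_map F p.
Proof.
move=> eF; rewrite /torus_map /torus_proj.
have [k kE] := frac_int p.1; have [l lE] := frac_int p.2; rewrite kE lE.
by have [k' [l' ->]] := eF p k l; rewrite /= !frac_addz.
Qed.

(** Reducing modulo 1 between the two maps is harmless because F sends points that differ by
    integers to points that differ by integers. *)
Lemma torus_map_comp (F G : Map) p : int_equivariant F ->
  torus_map F (torus_map G p) = torus_map (F \o G) p.
Proof. by move=> eF; rewrite -[RHS]/(torus_map F (G p)) -(torus_map_proj (G p) eF). Qed.

Lemma trans_equivariant (u : RR * RR) : int_equivariant (trans u).
Proof. by move=> p m n; exists m, n; rewrite /trans /=; congr (_, _); ring. Qed.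

Lemma measurable_fund_dom : measurable (fund_dom : set T2).
Proof.
have -> : (fund_dom : set T2) = `[0, 1[%classic `*` `[0, 1[%classic.
  by apply/seteqP; split => -[x y] /=; rewrite /fund_dom /= !in_itv.
by apply: measurableX; exact: measurable_itv.
Qed.

Lemma measurable_torus_proj : measurable_fun setT torus_proj.
Proof.
apply/measurable_fun_pair.
  by apply: (measurableT_comp measurable_frac); exact: measurable_fst.
by apply: (measurableT_comp measurable_frac); exact: measurable_snd.
Qed.

Lemma rat_near (c e : RR) : 0 < e -> exists q : rat, `|ratr q - c| < e.
Proof.
move=> e0; have [|q] := @rat_in_itvoo _ c (c + e); first by rewrite ltrDl.
rewrite in_itv /= => /andP[q1 q2]; exists q; rewrite ltr_norml; apply/andP; split; lra.
Qed.

(** The sigma-algebra of [T2] is the product one, so the set f > a is written as a countable union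
    of rational boxes. The margin 2 K / (n + 1) is the oscillation of f from the centre of a box; it
    is spent once to stay above a on the box and once to pass from p to the centre. *)
Lemma measurable_lipschitz (f : T2 -> measurableTypeR RR) (K : RR) : 0 <= K ->
  (forall p q, `|f p - f q| <= K * (`|p.1 - q.1| + `|p.2 - q.2|)) ->
  measurable_fun setT f.
Proof.
move=> K0 lf mD; apply: (measurability _ (RGenOInfty.measurableE RR)) => //.
move=> /= _ [_ [a ->] <-]; rewrite setTI.
pose box (i : rat * rat * nat) : set T2 :=
  if a + 2 * K / i.2.+1%:R < f (ratr i.1.1, ratr i.1.2)
  then ball (ratr i.1.1 : RR) i.2.+1%:R^-1 `*` ball (ratr i.1.2 : RR) i.2.+1%:R^-1 else set0.
have -> : f @^-1` `]a, +oo[%classic = \bigcup_i box i.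
  apply/seteqP; split => p /=; rewrite in_itv /= andbT.
    move=> ap; pose n := Num.truncn (4 * (K + 1) / (f p - a)).
    have fa : 0 < f p - a by rewrite subr_gt0.
    have n0 : (0 : RR) < n.+1%:R by rewrite ltr0n.
    have nf : 4 * (K + 1) / n.+1%:R < f p - a.
      by rewrite ltr_pdivrMr// [ltRHS]mulrC -ltr_pdivrMr// truncnS_gt.
    have ne : (0 : RR) < n.+1%:R^-1 by rewrite invr_gt0.
    have [q1 h1] := rat_near p.1 ne; have [q2 h2] := rat_near p.2 ne.
    exists (q1, q2, n) => //; rewrite /box /=.
    have := lf (ratr q1, ratr q2) p; rewrite /= ler_norml => /andP[lo _].
    have lo2 : K * (`|ratr q1 - p.1| + `|ratr q2 - p.2|) <= K * (n.+1%:R^-1 + n.+1%:R^-1).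
      by apply: ler_wpM2l => //; apply: lerD; exact: ltW.
    have e4 : 4 * (K + 1) / n.+1%:R = 4 * (K * n.+1%:R^-1) + 4 * n.+1%:R^-1 by ring.
    have e2 : 2 * K / n.+1%:R = 2 * (K * n.+1%:R^-1) by ring.
    rewrite ifT; first by split.
    rewrite e2; rewrite e4 in nf; rewrite [leRHS]mulrDr in lo2.
    by move: lo lo2 nf ne; set X := K * _; set Y := n.+1%:R^-1; set Z := K * Y; lra.
  move=> [[[q1 q2] n] _]; rewrite /box /=; case: ifP => // big [/= b1 b2].
  move: b1 b2; rewrite /ball /= => b1 b2.
  have := lf (ratr q1, ratr q2) p; rewrite /= ler_norml => /andP[_ hi].
  have : K * (`|ratr q1 - p.1| + `|ratr q2 - p.2|) <= K * (n.+1%:R^-1 + n.+1%:R^-1).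
    by apply: ler_wpM2l => //; apply: lerD; exact: ltW.
  have e2 : 2 * K / n.+1%:R = 2 * (K * n.+1%:R^-1) by ring.
  rewrite e2 in big; rewrite [leRHS]mulrDr => lo2.
  by move: hi lo2 big; set X := K * _; set Z := K * _; lra.
apply: countable_bigcupT_measurable; first exact: countableP.
move=> i; rewrite /box; case: ifP => // _.
by apply: measurableX; exact: measurable_ball.
Qed.

Lemma measurable_lipschitz2 (F : Map) : lipschitz2 F -> measurable_fun setT (F : T2 -> T2).
Proof.
move=> [K K0 lF]; apply/measurable_fun_pairP; split.
  by apply: (measurable_lipschitz K0) => p q; have [] := lF p q.
by apply: (measurable_lipschitz K0) => p q; have [] := lF p q.
Qed.

Lemma measurable_torus_map (F : Map) : lipschitz2 F -> measurable_fun setT (torus_map F).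
Proof.
by move=> /measurable_lipschitz2; exact: (measurableT_comp measurable_torus_proj).
Qed.

Lemma trans_lipschitz (u : RR * RR) : lipschitz2 (trans u).
Proof.
exists 1 => // p q; rewrite /trans /= !mul1r.
have -> : p.1 + u.1 - (q.1 + u.1) = p.1 - q.1 by ring.
have -> : p.2 + u.2 - (q.2 + u.2) = p.2 - q.2 by ring.
by rewrite lerDl lerDr.
Qed.

Lemma measurable_torus_map_preimage (F : Map) (A : set T2) : lipschitz2 F ->
  measurable A -> measurable (torus_map F @^-1` A).
Proof.
by move=> lF mA; rewrite -[X in measurable X]setTI; exact: (measurable_torus_map lF).
Qed.

(* [frac] is lower semicontinuous, so the preimages of rays under it are open. *)
Definition ray_rect (A : set T2) := exists a b : RR, A = `]a, +oo[%classic `*` `]b, +oo[%classic.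

(** The line is a countable union of rays, so the cylinders over rays, hence over all Borel sets,
    belong to the generated sigma-algebra. *)
Lemma ray_rect_generates : (measurable : set (set T2)) `<=` <<s ray_rect >>.
Proof.
have rayT : \bigcup_n (`](- n%:R), +oo[%classic) = setT :> set RR.
  apply/seteqP; split => // y _; exists (Num.truncn (- y)).+1 => //=.
  by rewrite in_itv /= andbT ltrNl truncnS_gt.
apply: smallest_sub; first exact: smallest_sigma_algebra.
have sg : sigma_algebra setT <<s ray_rect >> by exact: smallest_sigma_algebra.
rewrite subUset; split => _ [X mX <-]; rewrite setTI.
- have : <<s @RGenOInfty.G RR >> X.
    by have := mX; rewrite -[measurable X]/((@ocitv RR).-sigma.-measurable X) RGenOInfty.measurableE.
  apply: (@smallest_sub _ _ _ [set X | <<s ray_rect >> (fst @^-1` X)]); last first.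
    move=> _ [a ->] /=.
    have -> : fst @^-1` `]a, +oo[%classic = \bigcup_n (`]a, +oo[%classic `*` `](- n%:R), +oo[%classic) :> set T2.
      by rewrite -setX_bigcupr rayT setXT.
    by apply: sigma_algebra_bigcup => // n; apply: sub_sigma_algebra; exists a, (- n%:R).
  split => /=.
  + by rewrite preimage_set0; case: sg.
  + by move=> A; rewrite /= setTD preimage_setC => hA; case: sg => _ + _ => /(_ _ hA); rewrite setTD.
  + by move=> A hA /=; rewrite preimage_bigcup; case: sg => _ _; apply.
- have : <<s @RGenOInfty.G RR >> X.
    by have := mX; rewrite -[measurable X]/((@ocitv RR).-sigma.-measurable X) RGenOInfty.measurableE.
  apply: (@smallest_sub _ _ _ [set X | <<s ray_rect >> (snd @^-1` X)]); last first.
    move=> _ [a ->] /=.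
    have -> : snd @^-1` `]a, +oo[%classic = \bigcup_n (`](- n%:R), +oo[%classic `*` `]a, +oo[%classic) :> set T2.
      by rewrite -setX_bigcupl rayT setTX.
    by apply: sigma_algebra_bigcup => // n; apply: sub_sigma_algebra; exists (- n%:R), a.
  split => /=.
  + by rewrite preimage_set0; case: sg.
  + by move=> A; rewrite /= setTD preimage_setC => hA; case: sg => _ + _ => /(_ _ hA); rewrite setTD.
  + by move=> A hA /=; rewrite preimage_bigcup; case: sg => _ _; apply.
Qed.

Lemma measurable_ray_rect : ray_rect `<=` measurable.
Proof. by move=> _ [a [b ->]]; apply: measurableX; exact: measurable_itv. Qed.

Lemma ray_rect_setI : setI_closed ray_rect.
Proof.
move=> _ _ [a [b ->]] [c [d ->]]; exists (Num.max a c), (Num.max b d).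
rewrite -setXI; congr (_ `*` _); apply/seteqP; split => x /=;
  by rewrite !in_itv /= !andbT gt_max => /andP.
Qed.

Lemma T2_measure_unique (m1 m2 : {measure set T2 -> \bar RR}) :
  (m1 setT < +oo)%E -> (forall A, ray_rect A -> m1 A = m2 A) ->
  forall A, measurable A -> m1 A = m2 A.
Proof.
move=> fin H A mA.
pose g n : set T2 := `](- n%:R), +oo[%classic `*` `](- n%:R), +oo[%classic.
apply: (g_sigma_algebra_measure_unique ray_rect measurable_ray_rect g _ _ m1 m2 ray_rect_setI H).
- by move=> n; exists (- n%:R), (- n%:R).
- apply/seteqP; split => // p _; pose N := maxn (Num.truncn (- p.1)) (Num.truncn (- p.2)).
  exists N.+1 => //; split; rewrite /= in_itv /= andbT ltrNl;
    by apply: lt_le_trans (truncnS_gt _) _; rewrite ler_nat ltnS ?leq_maxl ?leq_maxr.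
- move=> n; apply: le_lt_trans fin; apply: le_measure; rewrite ?inE//.
  by apply: measurable_ray_rect; exists (- n%:R), (- n%:R).
- exact: ray_rect_generates.
Qed.

(** * From one dense orbit to invariance under all translations *)

Definition trans_invariant (mu : set T2 -> \bar RR) := forall (u : RR * RR) A,
  measurable A -> mu (torus_map (trans u) @^-1` A) = mu A.

Lemma torus_trans_preimageD (u w : RR * RR) (A : set T2) :
  torus_map (trans u) @^-1` (torus_map (trans w) @^-1` A) =
  torus_map (trans (u.1 + w.1, u.2 + w.2)) @^-1` A.
Proof.
have E p : torus_map (trans w) (torus_map (trans u) p) =
    torus_map (trans (u.1 + w.1, u.2 + w.2)) p.
  by rewrite (torus_map_comp _ _ (@trans_equivariant w)) /torus_map /trans /= !addrA.
by apply/seteqP; split => p /=; rewrite E.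
Qed.

Lemma measurable_trans_preimage (u : RR * RR) (A : set T2) : measurable A ->
  measurable (torus_map (trans u) @^-1` A).
Proof. exact: measurable_torus_map_preimage (trans_lipschitz u). Qed.

(** Inner approximation of the set where [frac] exceeds a, increasing in n. The margin 1/(n+1) is
    kept on both sides: above a, and below 1, where [frac] drops to 0. For negative a there is
    nothing to avoid. *)
Definition slab (a : RR) (n : nat) : set (measurableTypeR RR) :=
  if a < 0 then setT else frac @^-1` `]a + n.+1%:R^-1, 1 - n.+1%:R^-1[%classic.

Lemma measurable_slab a n : measurable (slab a n).
Proof.
rewrite /slab; case: ifP => // _; rewrite -[X in measurable X]setTI.
by apply: measurable_frac => //; exact: measurable_itv.
Qed.

Lemma slab_sub a n m x : (n <= m)%N -> slab a n x -> slab a m x.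
Proof.
rewrite /slab => nm; case: ifP => // _; rewrite /= !in_itv /= => /andP[h1 h2].
have : (m.+1%:R^-1 : RR) <= n.+1%:R^-1 by rewrite lef_pV2 ?posrE ?ltr0n// ler_nat.
move: h1 h2; set X : RR := n.+1%:R^-1; set Y : RR := m.+1%:R^-1 => *.
by apply/andP; split; lra.
Qed.

Lemma slab_exists a x : a < frac x -> exists n, slab a n x.
Proof.
move=> ax; rewrite /slab; case: (ltP a 0) => a0; first by exists 0%N.
have x1 := frac_lt1 x.
pose e := Num.min (frac x - a) (1 - frac x).
have e0 : 0 < e by rewrite /e lt_min; apply/andP; split; lra.
exists (Num.truncn e^-1); rewrite /= in_itv /=.
have : (Num.truncn e^-1).+1%:R^-1 < e.
  by rewrite invf_plt ?posrE ?ltr0n// truncnS_gt.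
set Y := _^-1; rewrite /e lt_min => /andP[? ?]; apply/andP; split; lra.
Qed.

Lemma slab_frac a n (x y : RR) : slab a n x -> `|y - x| < n.+1%:R^-1 -> a < frac y.
Proof.
rewrite /slab; case: ltP => a0; first by move=> _ _; exact: lt_le_trans (frac_ge0 y).
rewrite /= in_itv /= => /andP[h1 h2]; have [k kE] := frac_int x.
move: h1 h2; rewrite kE; set Y := _^-1 => h1 h2; rewrite ltr_norml => /andP[h3 h4].
rewrite -(frac_addz y k) frac_id; last by apply/andP; split; lra.
lra.
Qed.

Lemma pushforward_measure (mu : {measure set T2 -> \bar RR}) (f : T2 -> T2) :
  measurable_fun setT f ->
  {nu : {measure set T2 -> \bar RR} | forall A, nu A = mu (f @^-1` A)}.
Proof.
move=> mf; exists (@measure_function_pushforward__canonical__measure_function_Measure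
  _ _ T2 T2 RR mu f mf).
by [].
Qed.

Section DenseOrbitInvariance.
Variables (mu : {measure set T2 -> \bar RR}) (v : RR * RR).
Hypothesis vdense : dense_orbit v.
Hypothesis muv : forall A, measurable A -> mu (torus_map (trans v) @^-1` A) = mu A.

Lemma orbit_invariant (N : nat) (u : RR * RR) A : measurable A ->
  mu (torus_map (trans (u.1 + N%:R * v.1, u.2 + N%:R * v.2)) @^-1` A) =
  mu (torus_map (trans u) @^-1` A).
Proof.
move=> mA; elim: N => [|N IH]; first by rewrite !mul0r !addr0 -surjective_pairing.
rewrite -IH -[RHS]muv; last exact: measurable_trans_preimage.
rewrite torus_trans_preimageD; congr (mu (torus_map (trans (_, _)) @^-1` A)) => /=;
  by rewrite -natr1; ring.
Qed.

(** Some u' + N v is within 1/(n+1) of u modulo integers, so the n-th inner approximation of the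
    preimage for u lies in the preimage for u' + N v, whose measure is that for u'. Letting n grow
    gives the inequality, and exchanging u and u' the equality. *)
Lemma ray_rect_trans_le (u u' : RR * RR) A : ray_rect A ->
  (mu (torus_map (trans u) @^-1` A) <= mu (torus_map (trans u') @^-1` A))%E.
Proof.
move=> rA; have mA := measurable_ray_rect rA.
case: (rA) => a [b AE].
pose B n : set T2 := trans u @^-1` (slab a n `*` slab b n).
have mB n : measurable (B n).
  rewrite -[X in measurable X]setTI.
  apply: (measurable_lipschitz2 (trans_lipschitz u)) => //.
  by apply: measurableX; exact: measurable_slab.
have UB : \bigcup_n B n = torus_map (trans u) @^-1` A.
  apply/seteqP; split => p; rewrite AE /=.
    move=> [n _ [/= h1 h2]]; rewrite !in_itv /= !andbT.
    by split; [apply: slab_frac h1 _|apply: slab_frac h2 _];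
      rewrite subrr normr0 invr_gt0 ltr0n.
  rewrite !in_itv /= !andbT => -[/slab_exists[n h1] /slab_exists[m h2]].
  exists (maxn n m) => //; split => /=; [apply: slab_sub h1|apply: slab_sub h2].
    exact: leq_maxl.
  exact: leq_maxr.
have Bnd : {homo B : n m / (n <= m)%N >-> (n <= m)%O}.
  move=> n m nm; apply/subsetPset => p [/= h1 h2].
  by split => /=; [apply: slab_sub h1|apply: slab_sub h2].
have := @nondecreasing_cvg_mu _ _ _ mu B mB.
rewrite UB => /(_ (measurable_trans_preimage u mA) Bnd) cv.
rewrite -(cvg_lim _ cv)//; apply: lime_le; first by apply/cvg_ex; eexists; exact: cv.
apply: nearW => n /=.
have [|N [k [l [h1 h2]]]] := vdense (u.1 - u'.1, u.2 - u'.2) (e := n.+1%:R^-1).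
  by rewrite invr_gt0 ltr0n.
rewrite -(orbit_invariant N u' mA); apply: le_measure; rewrite ?inE//.
  exact: measurable_trans_preimage.
move=> p [/= s1 s2]; rewrite AE /=; split; rewrite /= in_itv /= andbT.
- rewrite -(frac_addz _ (- k)); apply: slab_frac s1 _.
  move: h1 => /=; congr (`|_| < _); rewrite intrN; ring.
- rewrite -(frac_addz _ (- l)); apply: slab_frac s2 _.
  move: h2 => /=; congr (`|_| < _); rewrite intrN; ring.
Qed.

Lemma dense_orbit_trans_invariant : (mu setT < +oo)%E -> trans_invariant mu.
Proof.
move=> fin u A mA.
have lu := trans_lipschitz u.
have [nu nuE] := pushforward_measure mu (measurable_torus_map lu).
rewrite -nuE; apply: T2_measure_unique mA; first by rewrite nuE preimage_setT.
move=> {}A rA; have mA := measurable_ray_rect rA; rewrite nuE.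
(* A itself is not a preimage under a translation of the torus; invariance under v puts [mu A] in
   that form, and the two vectors compared are u and v. *)
rewrite -[RHS]muv//; apply/eqP; rewrite eq_le.
by apply/andP; split; exact: ray_rect_trans_le.
Qed.

End DenseOrbitInvariance.

Section MeasureAsProbability.
Context d (T : measurableType d) (R : realType) (mu : {measure set T -> \bar R}).

(** The proof of total mass 1 is an argument of the alias, so that a probability structure can be
    declared on it and Fubini-Tonelli applied. *)
Definition as_probability (_ : mu setT = 1%E) : set T -> \bar R := mu.

Hypothesis muT : mu setT = 1%E.

HB.instance Definition _ := Measure.copy (as_probability muT) mu.

HB.instance Definition _ := Measure_isProbability.Build _ _ _ (as_probability muT) muT.

End MeasureAsProbability.

(* Fubini: integrate the indicator of [p + q \in A (mod 1)] in both orders. *)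
Lemma trans_invariant_unique (mu nu : {measure set T2 -> \bar RR}) :
  mu setT = 1%E -> nu setT = 1%E -> trans_invariant mu -> trans_invariant nu ->
  forall A, measurable A -> mu A = nu A.
Proof.
move=> muT nuT mui nui A mA.
pose P : probability T2 RR := as_probability muT.
pose Q : probability T2 RR := as_probability nuT.
have PE B : P B = mu B by [].
have QE B : Q B = nu B by [].
pose g (z : T2 * T2) : T2 := torus_map (trans z.2) z.1.
have mg : measurable_fun setT g.
  have m11 : measurable_fun setT ((fun z => z.1.1) : T2 * T2 -> measurableTypeR RR).
    exact: (measurableT_comp (@measurable_fst _ _ (measurableTypeR RR) (measurableTypeR RR))
      (@measurable_fst _ _ T2 T2)).
  have m12 : measurable_fun setT ((fun z => z.1.2) : T2 * T2 -> measurableTypeR RR).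
    exact: (measurableT_comp (@measurable_snd _ _ (measurableTypeR RR) (measurableTypeR RR))
      (@measurable_fst _ _ T2 T2)).
  have m21 : measurable_fun setT ((fun z => z.2.1) : T2 * T2 -> measurableTypeR RR).
    exact: (measurableT_comp (@measurable_fst _ _ (measurableTypeR RR) (measurableTypeR RR))
      (@measurable_snd _ _ T2 T2)).
  have m22 : measurable_fun setT ((fun z => z.2.2) : T2 * T2 -> measurableTypeR RR).
    exact: (measurableT_comp (@measurable_snd _ _ (measurableTypeR RR) (measurableTypeR RR))
      (@measurable_snd _ _ T2 T2)).
  apply/measurable_fun_pair.
    exact: (measurableT_comp measurable_frac (measurable_funD m11 m21)).
  exact: (measurableT_comp measurable_frac (measurable_funD m12 m22)).
pose f (z : T2 * T2) : \bar RR := (\1_(g @^-1` A) z)%:E.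
have mf : measurable_fun setT f.
  apply/measurable_EFinP; apply: measurable_indic.
  by rewrite -[X in measurable X]setTI; exact: mg.
have f0 z : (0 <= f z)%E by rewrite lee_fin.
have := fubini_tonelli (m1 := P) (m2 := Q) f mf f0.
have fQ p : (\int[Q]_q f (p, q) = nu A)%E.
  rewrite (eq_integral (fun q => (\1_(torus_map (trans p) @^-1` A) q)%:E)).
    rewrite integral_indic ?setIT//; last exact: measurable_trans_preimage.
    exact: nui.
  move=> q _; rewrite /f !indicE; congr ((_ : bool)%:R)%:E.
  have gE : g (p, q) = torus_map (trans p) q.
    by rewrite /g /torus_map /trans /= [p.1 + _]addrC [p.2 + _]addrC.
  by apply/idP/idP; rewrite !inE /= gE.
have fP q : (\int[P]_p f (p, q) = mu A)%E.
  rewrite (eq_integral (fun p => (\1_(torus_map (trans q) @^-1` A) p)%:E)).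
    rewrite integral_indic ?setIT//; last exact: measurable_trans_preimage.
    exact: mui.
  by move=> p _; rewrite /f !indicE; congr ((_ : bool)%:R)%:E; apply/idP/idP; rewrite !inE.
under eq_integral do rewrite fQ.
under [in RHS]eq_integral do rewrite fP.
rewrite !integral_cst//= !probability_setT !mule1 => ->.
by [].
Qed.

(** * Lebesgue measure on the torus *)

Lemma lebesgue_measure_shift (R : realType) (c : R) (A : set R) : measurable A ->
  lebesgue_measure ((fun x => x + c) @^-1` A) = lebesgue_measure A.
Proof.
move=> mA.
have mc : measurable_fun setT ((fun x => x + c) : measurableTypeR R -> measurableTypeR R).
  by apply: measurable_funD; [exact: measurable_id|exact: measurable_cst].
pose nu := @measure_function_pushforward__canonical__measure_function_Measure _ _
  (measurableTypeR R) (measurableTypeR R) R (@lebesgue_measure R) _ mc.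
rewrite -[LHS]/(nu A); apply/esym/lebesgue_measure_unique => //= _ [[a b]] _ <-.
rewrite -[RHS]/(lebesgue_measure ((fun x => x + c) @^-1` `]a, b]%classic)).
have -> : (fun x => x + c) @^-1` `]a, b]%classic = `]a - c, b - c]%classic.
  by apply/seteqP; split => x /=; rewrite !in_itv /= ltrBlDr lerBrDr.
rewrite !lebesgue_measure_itv /= !lte_fin ltrD2r; case: ifP => // _.
by rewrite -!EFinB; congr EFin; ring.
Qed.

(** With c the fractional part of u, the rotation is an exchange of two intervals: a shift by c on
    [0, 1 - c[ and by c - 1 on [1 - c, 1[. *)
Lemma lebesgue_measure_rotation (u : RR) (A : set (measurableTypeR RR)) : measurable A ->
  lebesgue_measure ((fun x => frac (x + u)) @^-1` A `&` `[0, 1[%classic) =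
  lebesgue_measure (A `&` `[0, 1[%classic) :> \bar RR.
Proof.
move=> mA; pose c := frac u.
have c0 : 0 <= c := frac_ge0 u; have c1 : c < 1 := frac_lt1 u.
have fc x : frac (x + u) = frac (x + c).
  by have [k kE] := frac_int u; rewrite /c kE addrA frac_addz.
have -> : (fun x => frac (x + u)) @^-1` A `&` `[0, 1[%classic =
   ((fun x => x + c) @^-1` (A `&` `[c, 1[%classic)) `|`
   ((fun x => x + (c - 1)) @^-1` (A `&` `[0, c[%classic)).
  apply/seteqP; split => x /=; rewrite !in_itv /= fc.
    move=> [Ax /andP[x0 x1]]; have [xc|xc] := ltP (x + c) 1.
      left; rewrite frac_id in Ax; last by apply/andP; split; lra.
      by split => //; apply/andP; split; lra.
    right; rewrite -(frac_addz _ (-1)) intrN frac_id in Ax; last by apply/andP; split; lra.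
    rewrite -addrA in Ax; split => //; apply/andP; split; lra.
  move=> [] [Ax /andP[x0 x1]]; (split; last by apply/andP; split; lra).
    by rewrite frac_id//; apply/andP; split; lra.
  rewrite -(frac_addz _ (-1)) intrN -addrA frac_id//; apply/andP; split; lra.
have mI (a b : RR) : measurable (A `&` `[a, b[%classic).
  by apply: measurableI => //; exact: measurable_itv.
have mS (d : RR) (B : set (measurableTypeR RR)) : measurable B ->
    measurable ((fun x => x + d) @^-1` B : set (measurableTypeR RR)).
  move=> mB; rewrite -[X in measurable X]setTI.
  have : measurable_fun setT ((fun x => x + d) : measurableTypeR RR -> measurableTypeR RR).
    by apply: measurable_funD; [exact: measurable_id|exact: measurable_cst].
  by move=> h; apply: h.
have -> : A `&` `[0, 1[%classic = (A `&` `[c, 1[%classic) `|` (A `&` `[0, c[%classic).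
  rewrite -setIUr setUC; congr (_ `&` _); apply/seteqP; split => x /=; rewrite !in_itv /=.
    by move=> /andP[x0 x1]; have [xc|xc] := ltP x c; [left|right]; apply/andP.
  by move=> [] /andP[? ?]; apply/andP; split; lra.
rewrite !measureU//; try exact: mI; try (apply: mS; exact: mI).
- by congr (_ + _)%E; apply: lebesgue_measure_shift; exact: mI.
- apply/seteqP; split => x //= [] [_]; rewrite in_itv /= => /andP[? ?] [_].
  by rewrite in_itv /= => /andP[? ?]; lra.
- apply/seteqP; split => x //= [] [_]; rewrite in_itv /= => /andP[? ?] [_].
  by rewrite in_itv /= => /andP[? ?]; lra.
Qed.

Definition leb_measure : {measure set T2 -> \bar RR} :=
  mrestr (@lebesgue_measure RR \x @lebesgue_measure RR)%E measurable_fund_dom.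

Lemma leb_T2_rect (X Y : set (measurableTypeR RR)) : measurable X -> measurable Y ->
  leb_T2 (X `*` Y) = (@lebesgue_measure RR (X `&` `[0%R, 1%R[%classic) *
    @lebesgue_measure RR (Y `&` `[0%R, 1%R[%classic))%E.
Proof.
move=> mX mY; rewrite /leb_T2 -product_measure1E.
- congr (_ _); apply/seteqP; split => -[x y] /=; rewrite /fund_dom /= !in_itv /=.
    by move=> [[? ?] [? ?]].
  by move=> [[? ?] [? ?]].
- by apply: measurableI => //; exact: measurable_itv.
- by apply: measurableI => //; exact: measurable_itv.
Qed.

Lemma leb_measure_setT : leb_measure setT = 1%E.
Proof.
rewrite -[LHS]/(leb_T2 setT) -setXTT leb_T2_rect// setTI lebesgue_measure_itv /=.
by rewrite lte_fin ltr01 -EFinB subr0 mule1.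
Qed.

(** On products of rays the claim factors into two rotations of the circle, and such products
    determine a finite measure. *)
Lemma leb_trans_invariant : trans_invariant leb_measure.
Proof.
move=> u A mA; have lu := trans_lipschitz u.
have [nu nuE] := pushforward_measure leb_measure (measurable_torus_map lu).
rewrite -nuE; apply: T2_measure_unique mA.
  by rewrite nuE preimage_setT leb_measure_setT ltry.
move=> _ [a [b ->]]; rewrite nuE.
have mr (x : RR) : measurable (`]x, +oo[%classic : set (measurableTypeR RR)) by exact: measurable_itv.
have mfr (d x : RR) : measurable ((fun y => frac (y + d)) @^-1` `]x, +oo[%classic : set (measurableTypeR RR)).
  rewrite -[X in measurable X]setTI.
  have : measurable_fun setT ((fun y => frac (y + d)) : measurableTypeR RR -> measurableTypeR RR).
    by apply: (measurableT_comp measurable_frac); apply: measurable_funD;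
      [exact: measurable_id|exact: measurable_cst].
  by move=> h; apply: h.
rewrite -[RHS]/(leb_T2 _) -[LHS]/(leb_T2 _) (leb_T2_rect (mr a) (mr b)).
rewrite -(lebesgue_measure_rotation u.1 (mr a)) -(lebesgue_measure_rotation u.2 (mr b)).
by rewrite -(leb_T2_rect (mfr _ _) (mfr _ _)).
Qed.

(** * Unique ergodicity *)

Lemma linmap_analytic_lift (a b c d : int) : analytic_lift (linmap a b c d).
Proof.
have z0 : real_analytic_periodic (fun _ _ => 0).
  split; first by [].
  exists 1; split => //; exists (fun=> 0); split; [|split => //].
    by apply/holomorphic_onE => z _; exact: hol_at_cst.
  by exists 0 => z _; rewrite normr0.
exists a, b, c, d; split.
- have := z0; congr real_analytic_periodic; apply/funext => x; apply/funext => y.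
  by rewrite /= subrr.
- have := z0; congr real_analytic_periodic; apply/funext => x; apply/funext => y.
  by rewrite /= subrr.
Qed.

(* The image of the Lebesgue measure is again translation invariant. *)
Lemma linmap_area_preserving (a b c d a' b' c' d' : int) :
  (forall p, linmap a b c d (linmap a' b' c' d' p) = p) ->
  area_preserving (linmap a b c d).
Proof.
move=> lK A mA; pose l := linmap a b c d; pose l' := linmap a' b' c' d'.
have al : analytic_lift l by exact: linmap_analytic_lift.
have el := analytic_lift_equivariant al.
have [nu nuE] := pushforward_measure leb_measure (measurable_torus_map (analytic_lift_lipschitz al)).
rewrite -[LHS]/(leb_measure (torus_map l @^-1` A)) -nuE -[RHS]/(leb_measure A).
apply: trans_invariant_unique mA; last exact: leb_trans_invariant.
- by rewrite nuE preimage_setT leb_measure_setT.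
- exact: leb_measure_setT.
move=> u B mB; rewrite !nuE.
have E p : torus_map (trans u) (torus_map l p) = torus_map l (torus_map (trans (l' u)) p).
  rewrite (torus_map_comp _ _ (@trans_equivariant u)) (torus_map_comp _ _ el).
  have /(congr1 fst) /= h1 := lK u; have /(congr1 snd) /= h2 := lK u.
  rewrite /torus_map /=; congr (Defs.frac _, Defs.frac _).
    by rewrite -[in LHS]h1; ring.
  by rewrite -[in LHS]h2; ring.
have -> : torus_map l @^-1` (torus_map (trans u) @^-1` B) =
    torus_map (trans (l' u)) @^-1` (torus_map l @^-1` B).
  by apply/seteqP; split => p /=; rewrite E.
apply: leb_trans_invariant.
exact: measurable_torus_map_preimage (analytic_lift_lipschitz al) mB.
Qed.

Section ConjugatePair.
Variables (T S : Map).
Hypotheses (aT : analytic_lift T) (aS : analytic_lift S).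
Hypotheses (SK : forall p, S (T p) = p) (TK : forall p, T (S p) = p).

(* Conjugating R_alpha by the unimodular matrix (-m, 1; -(1 + m d), d) gives the
   translation by (d alpha, (1 + m d) alpha) modulo integers. *)
Lemma A_alpha_conj_translation (alpha : RR) (d m k1 k2 : int) : area_preserving T ->
  A_alpha alpha (conj_trans S T (d%:~R * alpha + k1%:~R, (1 + m * d)%:~R * alpha + k2%:~R)).
Proof.
move=> arT; set w := (_, _).
have [rho [K [_ _ Dr _]]] := conj_trans_family aT aS SK TK.
split; first by have [] := Dr w.
(* The matrix has determinant - m d + (1 + m d) = 1 and sends (d alpha, (1 + m d) alpha) to (alpha,
   0). *)
pose l := linmap (- m) 1 (- (1 + m * d)) d.
pose l' := linmap d (-1) (1 + m * d) (- m).
have lK p : l (l' p) = p.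
  rewrite /l /l' /linmap /= [RHS]surjective_pairing !(intrN, intrD, intrM, mulr1z).
  by congr (_, _); ring.
have l'K p : l' (l p) = p.
  rewrite /l /l' /linmap /= [RHS]surjective_pairing !(intrN, intrD, intrM, mulr1z).
  by congr (_, _); ring.
exists (l \o T); split; [split|split].
- exact: analytic_lift_linmap_comp.
- exists (S \o l'); split; first exact: analytic_lift_comp_linmap.
  by split=> p /=; rewrite ?l'K ?SK ?TK ?lK.
- have el := analytic_lift_equivariant (linmap_analytic_lift (- m) 1 (- (1 + m * d)) d).
  have ll := analytic_lift_lipschitz (linmap_analytic_lift (- m) 1 (- (1 + m * d)) d).
  move=> A mA; have -> : torus_map (l \o T) @^-1` A = torus_map T @^-1` (torus_map l @^-1` A).
    by apply/seteqP; split => p /=; rewrite (torus_map_comp _ _ el).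
  rewrite arT; last exact: measurable_torus_map_preimage ll mA.
  exact: linmap_area_preserving lK A mA.
- move=> p; exists (k2 - m * k1), (d * k2 - (1 + m * d) * k1).
  rewrite /conj_trans /= TK /trans /l /linmap /= !(intrN, intrD, intrM, mulr1z).
  by congr (_, _); ring.
Qed.

Lemma conj_trans_closure (alpha : RR) (w : RR * RR) : irrational alpha ->
  area_preserving T -> tau_closure (A_alpha alpha) (conj_trans S T w).
Proof.
move=> /irrational_int_free ia arT.
have [rho [K [rho0 K0 Dr dist]]] := conj_trans_family aT aS SK TK.
split; first by have [] := Dr w.
move=> O [_ oO] Ow; have [eps [eps0 He]] := oO _ rho0 _ Ow (Dr w).
pose eta := eps / (2 * K + 2).
have eta0 : 0 < eta by rewrite divr_gt0//; lra.
(* Asking for d >= 1 keeps d alpha irrational, so that its multiples are dense in turn. *)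
have [d [k1 [d0 hd]]] := orbit_dense w.1 1 ia eta0.
have id : int_free (d%:R * alpha).
  by apply: (@int_freeZ _ _ d) ia; rewrite eqz_nat -lt0n.
(* The target is w.2 - alpha because (1 + m d) alpha = alpha + m (d alpha). *)
have [m [k2 [_ hm]]] := orbit_dense (w.2 - alpha) 0 id eta0.
exists (conj_trans S T ((d : int)%:~R * alpha + k1%:~R, (1 + (m : int) * d)%:~R * alpha + k2%:~R)).
split; last exact: A_alpha_conj_translation.
apply: He; first exact: Dr.
apply: dist => /=.
have h1 : `|w.1 - (d%:R * alpha + k1%:~R)| <= eta by rewrite distrC ltW.
have h2 : `|w.2 - ((1 + (m : int) * d)%:~R * alpha + k2%:~R)| <= eta.
  rewrite ltW//; apply: le_lt_trans hm; rewrite distrC; apply: eqR_le.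
  by congr `|_|; rewrite intrD intrM mulr1z; ring.
apply: (@le_lt_trans _ _ (K * (eta + eta))); first by apply: ler_wpM2l => //; exact: lerD.
have -> : K * (eta + eta) = eps * (2 * K / (2 * K + 2)) by rewrite /eta; field; lra.
by rewrite gtr_pMr// ltr_pdivrMr; lra.
Qed.

Let eT := analytic_lift_equivariant aT.
Let eS := analytic_lift_equivariant aS.

Lemma torus_conj_trans v p : torus_map (conj_trans S T v) p =
  torus_map S (torus_map (trans v) (torus_map T p)).
Proof.
by rewrite (torus_map_comp _ _ (@trans_equivariant v)) (torus_map_comp _ _ eS).
Qed.

Lemma torus_map_invr p : torus_map T (torus_map S p) = torus_proj p.
Proof. by rewrite (torus_map_comp _ _ eT) /torus_map /= TK. Qed.

Lemma torus_map_invl p : torus_map S (torus_map T p) = torus_proj p.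
Proof. by rewrite (torus_map_comp _ _ eS) /torus_map /= SK. Qed.

(** Existence: the image of Lebesgue measure under S is invariant. Uniqueness: the image under T of
    an invariant measure is invariant under R_v, hence under all translations, and the measure is
    recovered from this image through S. *)
Lemma conj_trans_uniquely_ergodic v : dense_orbit v ->
  uniquely_ergodic (conj_trans S T v).
Proof.
move=> vd; pose F := conj_trans S T v.
have lT := analytic_lift_lipschitz aT; have lS := analytic_lift_lipschitz aS.
split.
  have [mu muE] := pushforward_measure leb_measure (measurable_torus_map lS).
  exists mu; split; [|split].
  - by rewrite muE preimage_setT leb_measure_setT.
  - rewrite muE; have -> : torus_map S @^-1` (~` fund_dom) = set0; last exact: measure0.
    by apply/seteqP; split => p //=; case; exact: torus_map_fund.
  - move=> A mA; rewrite !muE.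
    have -> : torus_map S @^-1` (torus_map (conj_trans S T v) @^-1` A) =
        torus_map (trans v) @^-1` (torus_map S @^-1` A).
      apply/seteqP; split => p /=;
        by rewrite torus_conj_trans torus_map_invr (torus_map_proj _ (@trans_equivariant v)).
    by apply: leb_trans_invariant; exact: measurable_torus_map_preimage.
have push (mu : {measure set T2 -> \bar RR}) : invariant_prob F mu ->
  {nu : {measure set T2 -> \bar RR} | [/\ nu setT = 1%E, trans_invariant nu &
    forall A, measurable A -> mu A = nu (torus_map S @^-1` A)]}.
  move=> [mu1 [_ muF]].
  have [nu nuE] := pushforward_measure mu (measurable_torus_map lT).
  exists nu; split.
  - by rewrite nuE preimage_setT.
  - apply: dense_orbit_trans_invariant vd _ _; last by rewrite nuE preimage_setT mu1 ltry.
    move=> A mA; rewrite !nuE.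
    rewrite -[RHS]muF; last exact: measurable_torus_map_preimage.
    congr (mu _); apply/seteqP; split => p /=;
      by rewrite torus_conj_trans torus_map_invr torus_projK//; exact: torus_map_fund.
  - move=> A mA; rewrite nuE.
    have -> : torus_map T @^-1` (torus_map S @^-1` A) = torus_proj @^-1` A.
      by apply/seteqP; split => p /=; rewrite torus_map_invl.
    have mP : measurable (torus_proj @^-1` A).
      by rewrite -[X in measurable X]setTI; exact: measurable_torus_proj.
    (* S after T is the reduction modulo 1, which is not the identity off [fund_dom]. Invariance
       replaces both sets by their preimages under the torus map of F, whose values lie in
       [fund_dom]. *)
    rewrite -(muF _ mP) -(muF _ mA); congr (mu _); apply/seteqP; split => p /=;
      by rewrite torus_projK//; exact: torus_map_fund.
move=> mu nu /push[mu' [mu1 mut muE]] /push[nu' [nu1 nut nuE]] A mA.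
rewrite muE// nuE//; apply: trans_invariant_unique => //.
exact: measurable_torus_map_preimage.
Qed.

End ConjugatePair.

Theorem theoremA :
  exists E : set RR,
    E `<=` `[0, 1]%classic /\
    (exists U : nat -> set RR,
        (forall n, open (U n)) /\ E = (`[0, 1]%classic `&` \bigcap_n U n)) /\
    (forall x : RR, `[0, 1]%classic x -> forall e : RR, 0 < e ->
        exists y, E y /\ `|y - x| < e) /\
    forall alpha : RR, E alpha ->
      exists D : set Map,
        D `<=` tau_closure (A_alpha alpha) /\
        tau_closure (A_alpha alpha) `<=` tau_closure D /\
        (forall F, D F -> uniquely_ergodic F).
Proof.
exists (`[0, 1]%classic `&` irrational); split; first by move=> x [].
split.
  have [U oU UE] := @irrational_Gdelta RR; exists U; rewrite -UE; split => // n.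
  by have [] := oU n.
split.
  move=> x; rewrite /= in_itv /= => /andP[x0 x1] e e0.
  (* An irrational close to the midpoint of [0, 1] intersected with [x - e, x + e] is at once in
     [0, 1] and close to x. *)
  pose a := Num.max 0 (x - e); pose b := Num.min 1 (x + e).
  have [a0 ax] : 0 <= a /\ x - e <= a by rewrite /a !le_max !lexx orbT.
  have [b0 bx] : b <= 1 /\ b <= x + e by rewrite /b !ge_min !lexx orbT.
  have ab : a < b by rewrite /a /b gt_max !lt_min; apply/andP; split; apply/andP; split; lra.
  have [|y iy] := @irrational_near RR ((a + b) / 2) ((b - a) / 2).
    by rewrite divr_gt0// subr_gt0.
  rewrite ltr_norml => /andP[y1 y2]; exists y; split.
    by split => //; rewrite in_itv /=; apply/andP; split; lra.
  by rewrite ltr_norml; apply/andP; split; lra.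
move=> alpha [_ ia].
exists [set F | tau_closure (A_alpha alpha) F /\ uniquely_ergodic F].
split; first by move=> F [].
split; last by move=> F [].
move=> F [dF clF]; split => // O oO OF.
(* It suffices to approximate G: O is also a neighbourhood of this element of [A_alpha], whose form
   is known, while F is only a limit. *)
have [G [OG AG]] := clF O oO OF.
have [T [S [w [aT aS arT [SK TK] GE]]]] := A_alpha_conj_trans AG.
have [rho [K [rho0 K0 Dr dist]]] := conj_trans_family aT aS SK TK.
case: (oO) => _ /(_ _ rho0 _ OG); rewrite {}GE => /(_ (Dr w))[eps [eps0 He]].
pose eta := eps / (2 * K + 2).
have eta0 : 0 < eta by rewrite divr_gt0//; lra.
have [v [vd [v1 v2]]] := dense_orbit_near w eta0.
exists (conj_trans S T v); split; last first.
  split; first exact: conj_trans_closure.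
  exact: conj_trans_uniquely_ergodic.
apply: He; first exact: Dr.
apply: dist; apply: (@le_lt_trans _ _ (K * (eta + eta))).
  by apply: ler_wpM2l => //; apply: lerD; rewrite distrC ltW.
have -> : K * (eta + eta) = eps * (2 * K / (2 * K + 2)) by rewrite /eta; field; lra.
by rewrite gtr_pMr// ltr_pdivrMr; lra.
Qed.
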